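(* Consider a soft Multi-GM $(f_a)_{a\in\mathcal V}$ over a finite multi-graph $\mathcal G=(\mathcal V,\mathcal E)$ (with a fixed choice of primary orientation $\alpha_d$ of every edge $\alpha$) whose polynomial $h(x)=\prod_{a\in\mathcal V}h_a(x_a)$ is Bi-Stable. Let $\alpha^{(1)},\dots,\alpha^{(|\mathcal E|)}$ be an ordering of the edges, and let the sequence of Multi-GMs $m=0,1,\dots,|\mathcal E|$ be the corresponding edge-elimination sequence, with graphs $\mathcal G^{(m)}$, gauge variables $x^{(m)}$, polynomials $h^{(m)}(x^{(m)})$ and Variational BP estimates $Z^{(m;\mathrm{vbp})}$ (the Variational BP estimate of the partition function of the $m$-th Multi-GM in the sequence). Then: (1) each polynomial $h^{(m)}(x^{(m)})$, $m=0,\dots,|\mathcal E|$, is Bi-Stable; (2) the Variational BP estimates do not decrease along the sequence, and therefore $$Z^{(\mathrm{vbp})}=Z^{(0;\mathrm{vbp})}\le Z^{(1;\mathrm{vbp})}\le\cdots\le Z^{(|\mathcal E|;\mathrm{vbp})}=Z,$$ where $Z$ is the partition function of the original Multi-GM.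
   Context: Multi-graph notation. $\mathcal G=(\mathcal V,\mathcal E)$ is a finite undirected multi-graph; multiple edges and self-edges are allowed. Each $\alpha\in\mathcal E$ has two directed versions, $\alpha_d$ (primary) and its reverse $\bar\alpha_d$; $\mathcal E_d$ is the set of all $2|\mathcal E|$ directed edges, and $u(\alpha_d)=u(\bar\alpha_d)=\alpha$. Each directed edge is attached to exactly one node: for an edge joining two distinct nodes (''normal'' edge) one of its two directed versions is attached to each end node; for a self-edge both directed versions are attached to its node. $e_d(a)$ is the set of directed edges attached to node $a$, and $\Sigma_a=\{0,1\}^{e_d(a)}$. Multi-GM. Factors $f_a:\Sigma_a\to[0,\infty)$, $a\in\mathcal V$. For $\sigma\in\{0,1\}^{\mathcal E}$, $\sigma_a\in\Sigma_a$ is given by $(\sigma_a)_\gamma=\sigma_{u(\gamma)}$ for $\gamma\in e_d(a)$. Partition function: $Z=\sum_{\sigma\in\{0,1\}^{\mathcal E}}\prod_{a}f_a(\sigma_a)$. The Multi-GM is soft if $f_a(s)>0$ for all $a$, $s\in\Sigma_a$. Polynomials. With variables $x=(x_\gamma)_{\gamma\in\mathcal E_d}$ and $x_a=(x_\gamma)_{\gamma\in e_d(a)}$, $h_a(x_a)=\sum_{s\in\Sigma_a}f_a(s)\prod_{\gamma\in e_d(a)}x_\gamma^{s_\gamma}$ and $h(x)=\prod_a h_a(x_a)$. Variational BP estimate. Let $\Pi$ be the set of $(b,\beta)$ with $b=(b_a(s))_{a\in\mathcal V,s\in\Sigma_a}\in[0,1]^{\sqcup_a\Sigma_a}$, $\beta\in[0,1]^{\mathcal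 E}$, such that $\sum_{s\in\Sigma_a}b_a(s)=1$ for all $a$ and $\sum_{s\in\Sigma_a,\,s_\gamma=1}b_a(s)=\beta_{u(\gamma)}$ for all $a$ and $\gamma\in e_d(a)$. Then $-\log Z^{(\mathrm{vbp})}=\min_{(b,\beta)\in\Pi}F^{(bp)}(b,\beta)$ with $$F^{(bp)}(b,\beta)=\sum_{a}\sum_{s\in\Sigma_a}b_a(s)\log\frac{b_a(s)}{f_a(s)}-\sum_{\alpha\in\mathcal E}\bigl(\beta_\alpha\log\beta_\alpha+(1-\beta_\alpha)\log(1-\beta_\alpha)\bigr),\quad 0\log0=0.$$ Edge-elimination sequence. Start with $\mathcal G^{(0)}=\mathcal G$, $f^{(0)}_a=f_a$. At step $m$, edge $\alpha=\alpha^{(m)}$ is contracted: $\mathcal E^{(m)}=\mathcal E^{(m-1)}\setminus\{\alpha\}$, and factors of nodes not incident to $\alpha$ are unchanged. If $\alpha$ is a self-edge at $a$, the new factor at $a$ is $f_a^{(m)}(s)=\sum_{\tau\in\{0,1\}}f_a^{(m-1)}(s,\,s_{\alpha_d}=s_{\bar\alpha_d}=\tau)$, $s$ indexed by $e_d^{(m-1)}(a)\setminus\{\alpha_d,\bar\alpha_d\}$. If $\alpha$ joins distinct nodes $b\ne c$, these are merged into one node $a$ with $e_d^{(m)}(a)=(e_d^{(m-1)}(b)\cup e_d^{(m-1)}(c))\setminus\{\alpha_d,\bar\alpha_d\}$ and factor $f_a^{(m)}(s)=\sum_{\tau\in\{0,1\}}f_b^{(m-1)}(s|_b,\tau)\,f_c^{(m-1)}(s|_c,\tau)$,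 where $\tau$ is the value on the directed version of $\alpha$ attached to $b$, resp. $c$. $x^{(m)}$ is $x$ with the variables of $\alpha^{(1)},\dots,\alpha^{(m)}$ removed, and $h^{(m)}(x^{(m)})$ is the polynomial $h$ of the $m$-th Multi-GM. Stability. A nonzero polynomial $g\in\mathbb R[x_1,\dots,x_N]$ is Real Stable if it has no root $z\in\mathbb C^N$ with $\mathrm{Im}(z_i)>0$ for all $i$. A polynomial $h(x_{\alpha^{(1)}_d},x_{\bar\alpha^{(1)}_d};x_{\alpha^{(2)}_d},x_{\bar\alpha^{(2)}_d};\dots)$ is Bi-Stable if $h(x_{\alpha^{(1)}_d},-x_{\bar\alpha^{(1)}_d};x_{\alpha^{(2)}_d},-x_{\bar\alpha^{(2)}_d};\dots)$ (sign flipped on the second variable of every pair) is Real Stable. *)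

(* Defs.v *)
From HB Require Import structures.
From mathcomp Require Import all_boot all_order all_algebra.
From mathcomp Require Import reals complex mpoly.
From mathcomp Require classical_sets sequences exp.

Set Implicit Arguments.
Unset Strict Implicit.
Unset Printing Implicit Defensive.

Import Order.TTheory GRing.Theory Num.Theory.

Local Open Scope ring_scope.

(* A directed edge is a pair [(alpha, d)] in [E * bool]: [(alpha, true)] is the
   primary version of the edge [alpha] and [(alpha, false)] is its reverse. *)
Definition primary {E : finType} (alpha : E) : E * bool := (alpha, true).
Definition reverse {E : finType} (alpha : E) : E * bool := (alpha, false).

(* The carriers [V] and [E] stay fixed while edges are contracted; [nodes] and
   [edges] are the nodes and edges actually present in the multi-graph, and
   [attach] sends a directed edge to the node it is attached to, so that
   [alpha] is a self-edge iff both of its directed versions are sent to the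
   same node.  A configuration [s] in {0,1}^D, for a set [D] of (directed)
   edges, is encoded as the subset of [D] on which it takes the value 1; the
   values of [attach] and [factor] outside the present edges, nodes and
   configurations are irrelevant. *)
Record multiGM (R : Type) (V E : finType) := MultiGM {
  nodes : {set V};
  edges : {set E};
  attach : E * bool -> V;
  factor : V -> {set E * bool} -> R }.

Definition fullGM (R : Type) (V E : finType) (attach : E * bool -> V)
    (f : V -> {set E * bool} -> R) : multiGM R V E :=
  MultiGM [set: V] [set: E] attach f.

Section MultiGM.
Variables (R : realType) (V E : finType).
Implicit Types (G : multiGM R V E) (a : V) (alpha : E).

Definition dedges G : {set E * bool} := [set g | g.1 \in edges G].

Definition dedges_at G a : {set E * bool} :=
  [set g in dedges G | attach G g == a].

Definition Sigma G a : {set {set E * bool}} := powerset (dedges_at G a).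

Definition soft G : Prop :=
  forall a s, a \in nodes G -> s \in Sigma G a -> 0 < factor G a s.

(* [sigma_a], for [sigma] in {0,1}^E *)
Definition localize G (sigma : {set E}) a : {set E * bool} :=
  [set g in dedges_at G a | g.1 \in sigma].

Definition partition_function G : R :=
  \sum_(sigma in powerset (edges G))
    \prod_(a in nodes G) factor G a (localize G sigma a).

(* The polynomial ring has exactly one variable for each present directed edge:
   ['X_i] is the variable x_g for the directed edge [g = enum_val i]. *)
Definition node_poly G a : {mpoly R[#|dedges G|]} :=
  \sum_(s in Sigma G a)
    factor G a s *: \prod_(i < #|dedges G| | enum_val i \in s) 'X_i.

Definition gm_poly G : {mpoly R[#|dedges G|]} :=
  \prod_(a in nodes G) node_poly G a.

Definition real_stable n (p : {mpoly R[n]}) : Prop :=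
  p != 0 /\
  forall z : 'I_n -> R[i], (forall i, 0 < complex.Im (z i)) ->
    (map_mpoly (real_complex R) p).@[z] != 0.

Definition flip_reverse G (p : {mpoly R[#|dedges G|]}) :
    {mpoly R[#|dedges G|]} :=
  p \mPo [tuple (if (enum_val i).2 then 'X_i else - 'X_i) | i < #|dedges G|].

Definition bi_stable G (p : {mpoly R[#|dedges G|]}) : Prop :=
  real_stable (flip_reverse p).

(* [q.1] is the family of beliefs [b] and [q.2] is [beta]. *)
Definition local_polytope G
    (q : (V -> {set E * bool} -> R) * (E -> R)) : Prop :=
  [/\ forall a s, a \in nodes G -> s \in Sigma G a -> 0 <= q.1 a s <= 1,
      forall alpha, alpha \in edges G -> 0 <= q.2 alpha <= 1,
      forall a, a \in nodes G -> \sum_(s in Sigma G a) q.1 a s = 1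
    & forall a g, a \in nodes G -> g \in dedges_at G a ->
        \sum_(s in Sigma G a | g \in s) q.1 a s = q.2 g.1].

(* Since [0 * _ = 0], the convention [0 log 0 = 0] holds automatically.  The
   formula is meaningful for soft models only, because [ln (x / 0) = 0]. *)
Definition bethe_free_energy G
    (q : (V -> {set E * bool} -> R) * (E -> R)) : R :=
  \sum_(a in nodes G) \sum_(s in Sigma G a)
      q.1 a s * exp.ln (q.1 a s / factor G a s)
  - \sum_(alpha in edges G)
      (q.2 alpha * exp.ln (q.2 alpha)
       + (1 - q.2 alpha) * exp.ln (1 - q.2 alpha)).

Definition is_min_bethe G (v : R) : Prop :=
  (exists2 q, local_polytope G q & bethe_free_energy G q = v) /\
  (forall q, local_polytope G q -> v <= bethe_free_energy G q).

(* For a soft model, [local_polytope G] is nonempty and, up to the irrelevant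
   values of [q], compact, and [bethe_free_energy G] is continuous on it, so
   that the minimum exists and the default value [0] is not used. *)
Definition min_bethe G : R := classical_sets.xget 0 (is_min_bethe G).

Definition Zvbp G : R := sequences.expR (- min_bethe G).

(* The two end nodes of a normal edge are merged into the one to which the
   primary version is attached; the name of the other one is discarded. *)
Definition contract G alpha : multiGM R V E :=
  let b := attach G (primary alpha) in
  let c := attach G (reverse alpha) in
  let set_to (t : bool) (D s : {set E * bool}) := if t then s :|: D else s in
  {| nodes := if b == c then nodes G else nodes G :\ c;
     edges := edges G :\ alpha;
     attach := fun g => if attach G g == c then b else attach G g;
     factor := fun a s =>
       if a != b then factor G a s
       else if b == c then
         \sum_(t : bool)
           factor G b (set_to t [set primary alpha; reverse alpha] s)
       else
         \sum_(t : bool)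
           factor G b (set_to t [set primary alpha] (s :&: dedges_at G b)) *
           factor G c (set_to t [set reverse alpha] (s :&: dedges_at G c)) |}.

Definition eliminate G (al : seq E) (m : nat) : multiGM R V E :=
  foldl contract G (take m al).

End MultiGM.

(* Main.v *)
(** Whether [al] is a normal edge or a self-edge, contracting it replaces the
    coefficient [weight G S] of the monomial [S] of the polynomial of the model
    by [weight G S + weight G S'], where [S'] is [S] with the two directed
    versions of [al] added. After the sign flip the sum becomes a difference:
    the Lieb-Sokal operation, which preserves stability.

    For marginals [beta] in the open interval (0,1), the minimum over the
    beliefs of [\sum b ln (b / f)] is the maximum over the gauges [x > 0] of
    [\sum beta_g ln x_g - ln h(x)]. Comparing the Bethe free energies before and
    after the contraction of [al] thus amounts to
      inf_(x, y > 0) (p00 + p10 x + p01 y + p11 x y) / (x y)^t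
        <= (p00 + p11) / (t^t (1 - t)^(1 - t)),
    where [t = beta_al] and the [p_ij > 0] are obtained from [h] by specializing
    the other variables. This holds as soon as [p10 p01 <= p00 p11], which is
    what Bi-Stability says about bivariate real specializations. Boundary points
    of the polytope are limits of interior ones. Contraction preserves the
    partition function, and an edgeless model has a single configuration. *)

Require Import Defs.
From HB Require Import structures.
From mathcomp Require Import all_boot all_order all_algebra.
From mathcomp Require Import reals complex.
From mathcomp Require mpoly.
From mathcomp Require boolp classical_sets topology normedtype derive.
From mathcomp Require Import sequences exp ring lra.

Set Implicit Arguments.
Unset Strict Implicit.
Unset Printing Implicit Defensive.

Import Order.TTheory GRing.Theory Num.Theory.

Local Open Scope ring_scope.

(** * Multiaffine polynomials *)

Section Multiaffine.
Variables (T : finType) (K : comNzRingType).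
Implicit Types (c : {set T} -> K) (D S : {set T}) (x : T -> K).

(** Coefficients are indexed by all subsets of a fixed type and [D] selects the variables, so that
    removing variables does not change the type of the polynomial. *)
Definition maff c D x : K := \sum_(S in powerset D) c S * \prod_(g in S) x g.

Lemma big_powersetU1 (A : nmodType) (F : {set T} -> A) i D : i \notin D ->
  \sum_(S in powerset (i |: D)) F S =
  \sum_(S in powerset D) F S + \sum_(S in powerset D) F (i |: S).
Proof.
move=> iD; rewrite (bigID (fun S : {set T} => i \in S)) /= addrC; congr (_ + _).
  apply: eq_bigl => S; rewrite !powersetE; apply/andP/idP => [[SD iS]|SD].
    by apply/subsetP => g gS; move/subsetP/(_ g gS): SD; rewrite in_setU1;
      case/orP => // /eqP gi; rewrite -gi gS in iS.
  split; first exact: subset_trans SD (subsetU1 _ _).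
  by apply: contra iD => iS; move/subsetP: SD; apply.
rewrite (reindex_onto (fun S => i |: S) (fun S => S :\ i)) /=; last first.
  by move=> S /andP[_ iS]; rewrite setD1K.
apply: eq_bigl => S; rewrite !powersetE setU11 andbT.
apply/andP/idP => [[SD /eqP SE]|SD].
  rewrite -SE; apply/subsetP => g; rewrite in_setD1 => /andP[gi gS].
  by move/subsetP/(_ g gS): SD; rewrite in_setU1 (negbTE gi).
split; first exact: setUS.
by apply/eqP/setU1K; apply: contra iD; move/subsetP: SD; apply.
Qed.

Lemma maff_set0 c x : maff c set0 x = c set0.
Proof. by rewrite /maff powerset0 big_set1 big_set0 mulr1. Qed.

Lemma maff_setU1 c D x i : i \notin D ->
  maff c (i |: D) x = maff c D x + x i * maff (fun S => c (i |: S)) D x.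
Proof.
move=> iD; rewrite /maff big_powersetU1 //; congr (_ + _).
rewrite mulr_sumr; apply: eq_bigr => S; rewrite powersetE => SD.
rewrite big_setU1 ?mulrA 1?(mulrC (c _)) //.
by apply: contra iD; move/subsetP: SD; apply.
Qed.

Lemma eq_maff c c' D x x' :
  (forall S, S \subset D -> c S = c' S) -> {in D, x =1 x'} ->
  maff c D x = maff c' D x'.
Proof.
move=> cc xx; apply: eq_bigr => S; rewrite powersetE => SD.
rewrite cc //; congr (_ * _); apply: eq_bigr => g gS; apply: xx.
by move/subsetP: SD; apply.
Qed.

Lemma maffD c c' D x :
  maff (fun S => c S + c' S) D x = maff c D x + maff c' D x.
Proof. by rewrite /maff -big_split; apply: eq_bigr => S _; rewrite mulrDl. Qed.

Lemma maffZ k c D x : maff (fun S => k * c S) D x = k * maff c D x.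
Proof. by rewrite /maff mulr_sumr; apply: eq_bigr => S _; rewrite mulrA. Qed.

Lemma maff_scale (e : T -> K) c D x :
  maff c D (fun g => e g * x g) = maff (fun S => (\prod_(g in S) e g) * c S) D x.
Proof.
by apply: eq_bigr => S _; rewrite big_split /= mulrA (mulrC (c S)).
Qed.

(** Distributivity: since the fibres of [at_] partition [D], choosing a subset of each fibre amounts
    to choosing a subset of [D]. In the proof [J] glues the choices and [I] cuts a subset into its
    traces. *)
Lemma maff_prod (A : finType) (at_ : T -> A) (N : {set A}) D
    (phi : A -> {set T} -> K) x : {in D, forall g, at_ g \in N} ->
  \prod_(a in N) maff (phi a) [set g in D | at_ g == a] x =
  maff (fun S => \prod_(a in N) phi a (S :&: [set g in D | at_ g == a])) D x.
Proof.
move=> DN; pose Dt a := [set g in D | at_ g == a].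
rewrite /maff (big_distr_big_dep set0).
pose J (F : {ffun A -> {set T}}) := \bigcup_(a in N) F a.
pose I (S : {set T}) := [ffun a => if a \in N then S :&: Dt a else set0].
rewrite [RHS](reindex_onto J I) /=; last first.
  move=> S; rewrite powersetE => /subsetP SD; apply/setP => g.
  apply/bigcupP/idP => [[a aN]|gS]; first by rewrite ffunE aN inE => /andP[].
  by exists (at_ g); rewrite ?ffunE DN ?SD // !inE gS SD // eqxx.
have famE F : F \in pfamily set0 N (fun a => mem (powerset (Dt a))) ->
    forall a, J F :&: Dt a = F a.
  case/pfamilyP => /subsetP sF subF a.
  have FD b : b \in N -> F b \subset Dt b.
    by move=> bN; rewrite -powersetE; exact: subF b bN.
  apply/setP => g; apply/setIP/idP => [[/bigcupP[b bN gb]]|ga].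
    have := subsetP (FD b bN) g gb; rewrite !inE => /andP[_ /eqP gE].
    by case/andP => _ /eqP <-; rewrite gE.
  have aN : a \in N by apply: contraLR ga => aN;
    move: (contra (sF a) aN); rewrite inE negbK => /eqP ->; rewrite inE.
  by split; [apply/bigcupP; exists a|exact: (subsetP (FD a aN))].
apply: eq_big => F.
  apply/idP/andP => [FF|[JD /eqP IJ]].
    have FD a : F a \subset Dt a by rewrite -(famE F FF a) subsetIr.
    split; first rewrite powersetE; first apply/bigcupsP => a aN.
      by apply: subset_trans (FD a) _; apply/subsetP => g; rewrite inE => /andP[].
    apply/eqP/ffunP => a; rewrite ffunE; case: ifP => [aN|aN].
      exact: famE.
    case/pfamilyP: FF => /subsetP sF _; apply/esym/eqP.
    by apply: contraFT aN => aN; apply: sF; rewrite inE.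
  rewrite -IJ; apply/pfamilyP; split => [|a aN].
    by apply/subsetP => a; rewrite inE ffunE; case: ifP; rewrite // eqxx.
  suff : I (J F) a \in powerset (Dt a) by [].
  by rewrite ffunE aN powersetE subsetIr.
move=> FF; rewrite big_split /=; congr (_ * _).
  by apply: eq_bigr => a aN; rewrite (famE F FF).
rewrite (partition_big at_ (mem N)) /=; last first.
  move=> g /bigcupP[a aN]; rewrite -(famE F FF a) !inE => /andP[_ /andP[_]].
  by move=> /eqP ->.
apply: eq_bigr => a aN; apply: eq_bigl => g.
rewrite -(famE F FF a) !inE; case gJ: (g \in J F) => //=.
have -> // : g \in D.
case/bigcupP: gJ => b bN; rewrite -(famE F FF b) !inE.
by case/andP => _ /andP[].
Qed.

End Multiaffine.

Section RealMultiaffine.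
Variables (R : realDomainType) (T : finType).
Implicit Types (c : {set T} -> R) (D S : {set T}) (x : T -> R).

Lemma maff_gt0 c D x : (forall S, S \subset D -> 0 < c S) ->
  {in D, forall g, 0 < x g} -> 0 < maff c D x.
Proof.
move=> c0 x0; rewrite /maff (bigD1 set0) ?powersetE ?sub0set //=.
apply: ltr_pwDl.
  by rewrite big_set0 mulr1 c0 ?sub0set.
apply: sumr_ge0 => S /andP[]; rewrite powersetE => SD _.
apply: mulr_ge0; first exact/ltW/c0.
by apply: prodr_ge0 => g gS; apply/ltW/x0/(subsetP SD).
Qed.

End RealMultiaffine.

(** * Stability *)

Section HalfPlane.
Variable R : rcfType.
Implicit Types (x y u v : R[i]).

Local Notation normc := (@ComplexField.Normc.normc R).
Local Notation Im := (@complex.Im R).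

Lemma ImD x y : Im (x + y) = Im x + Im y.
Proof. by case: x; case: y. Qed.

Lemma ImN x : Im (- x) = - Im x.
Proof. by case: x. Qed.

Lemma ImV x : Im x^-1 = - (Im x / (complex.Re x ^+ 2 + Im x ^+ 2)).
Proof. by case: x. Qed.

Lemma Im_gt0_neq0 x : 0 < Im x -> x != 0.
Proof. by apply: contraTneq => ->; rewrite /= ltxx. Qed.

Lemma ImV_lt0 x : 0 < Im x -> Im x^-1 < 0.
Proof.
move=> x0; rewrite ImV oppr_lt0 divr_gt0 //.
by apply: ltr_wpDl; [exact: sqr_ge0|exact: exprn_gt0].
Qed.

Lemma Im_le_normc x : `|Im x| <= normc x.
Proof.
case: x => a b /=; rewrite -sqrtr_sqr ler_sqrt ?addr_ge0 ?sqr_ge0 //.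
by rewrite lerDr sqr_ge0.
Qed.

Lemma normc_ge0 x : 0 <= normc x.
Proof. exact: le_trans (normr_ge0 _) (Im_le_normc x). Qed.

Lemma normc_gt0 x : (0 < normc x) = (x != 0).
Proof.
rewrite lt_def normc_ge0 andbT; congr (~~ _).
apply/eqP/eqP => [/ComplexField.Normc.eq0_normc //|->].
exact: ComplexField.Normc.normc0.
Qed.

Lemma Im_perturb x u : normc u < Im x -> 0 < Im (x + u).
Proof. by move=> ux; rewrite ImD; have := Im_le_normc u; rewrite ler_norml; lra. Qed.

Lemma normcD_neq0 x u : normc u < normc x -> x + u != 0.
Proof.
move=> ux; apply: contraTneq ux => /(canRL (addrK u)); rewrite add0r => ->.
by rewrite normcN ltxx.
Qed.

Lemma half_plane_small (e : R) : 0 < e -> exists2 x, 0 < Im x & normc x < e.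
Proof.
move=> e0; exists (Complex 0 (e / 2)) => /=; first lra.
rewrite expr0n /= add0r sqrtr_sqr ger0_norm; lra.
Qed.

End HalfPlane.

Section Stability.
Variables (R : rcfType) (T : finType).
Implicit Types (c : {set T} -> R[i]) (D S : {set T}) (z : T -> R[i]).

Local Notation normc := (@ComplexField.Normc.normc R).
Local Notation Im := (@complex.Im R).

(** Coefficients are complex so that single variables can be fixed at points of the half-plane,
    which is what inductions on [D] do through [mastableU1]. *)
Definition mastable c D : Prop :=
  forall z, (forall g, 0 < Im (z g)) -> maff c D z != 0.

Lemma maffDZ c c' (t : R[i]) D z :
  maff (fun S => c S + t * c' S) D z = maff c D z + t * maff c' D z.
Proof. by rewrite maffD maffZ. Qed.

Lemma eq_mastable c c' D :
  (forall S : {set T}, S \subset D -> c S = c' S) -> mastable c D -> mastable c' D.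
Proof. by move=> cc cD z /cD; rewrite (@eq_maff _ _ c c' D z z). Qed.

Lemma mastableZ (k : R[i]) c D : k != 0 ->
  mastable c D -> mastable (fun S => k * c S) D.
Proof. by move=> k0 cD z /cD; rewrite maffZ mulf_eq0 negb_or k0. Qed.

Lemma mastableU1 c D i : i \notin D ->
  mastable c (i |: D) <->
  forall t, 0 < Im t -> mastable (fun S => c S + t * c (i |: S)) D.
Proof.
move=> iD; split => [cD t t0 z z0|cD z z0].
  have := cD (fun g => if g == i then t else z g).
  rewrite maff_setU1 // eqxx maffDZ.
  rewrite (@eq_maff _ _ c c D _ z) // => [|g gD]; last first.
    by case: eqP gD iD => // -> ->.
  rewrite (@eq_maff _ _ (fun S => c (i |: S)) (fun S => c (i |: S)) D _ z) //.
    by apply=> g; case: eqP.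
  by move=> g gD; case: eqP gD iD => // -> ->.
by rewrite maff_setU1 // -maffDZ; exact: cD.
Qed.

(* Hurwitz' theorem for multiaffine polynomials. The root [t] of an affine
   function [a0 + t * a1] depends continuously on the coefficients when
   [a1 != 0]; the leading coefficient [c0 (i |: _)], when it does not vanish
   identically, is itself a limit of stable polynomials, by letting the [i]-th
   variable tend to infinity. *)
Lemma hurwitz D c0 c1 :
  (forall e : R, 0 < e -> exists2 x, normc x < e &
     mastable (fun S => c0 S + x * c1 S) D) ->
  (exists2 S : {set T}, S \subset D & c0 S != 0) ->
  mastable c0 D.
Proof.
have [n] := ubnP #|D|; elim: n D c0 c1 => // n IH D c0 c1.
case: (set_0Vmem D) => [-> _ _ [S]|[i iD]].
  by rewrite subset0 => /eqP -> c00 z _; rewrite maff_set0.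
rewrite -(setD1K iD) cardsU1 setD11 /= add1n ltnS; set D' := D :\ i => Dn.
have iD' : i \notin D' by rewrite setD11.
move=> lim [S SD cS].
have limU e : 0 < e -> exists2 x, normc x < e & forall t, 0 < Im t ->
    mastable (fun S => c0 S + x * c1 S + t * (c0 (i |: S) + x * c1 (i |: S))) D'.
  by case/lim => x xe /(mastableU1 _ iD') st; exists x.
move=> z z0; rewrite maff_setU1 //.
(* If the leading coefficient vanishes identically, fixing the variable at [z i] leaves a limit in
   fewer variables, covered by induction. *)
case: (boolP [exists S in powerset D', c0 (i |: S) != 0]); last first.
  move=> /exists_inPn A10.
  have A1E (S' : {set T}) : S' \subset D' -> c0 (i |: S') = 0.
    by move=> S'D; apply/eqP; have := A10 S'; rewrite powersetE S'D negbK; apply.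
  rewrite [X in _ * X](@eq_maff _ _ _ (fun=> 0 * 0) D' z z) //; last first.
    by move=> S' /A1E ->; rewrite mul0r.
  rewrite maffZ mul0r mulr0 addr0.
  apply: (IH D' c0 (fun S => c1 S + z i * c1 (i |: S)) Dn _ _ z z0).
    move=> e /limU[x xe st]; exists x => //.
    apply: eq_mastable (st _ (z0 i)) => S' /A1E ->; ring.
  have [iS|iS] := boolP (i \in S); last first.
    by exists S => //; rewrite -(setU1K iD') subsetD1 SD.
  case/negP: cS; rewrite -(setD1K iS) A1E //.
  by rewrite subDset setUC; rewrite setUC in SD.
move=> /exists_inP[S1]; rewrite powersetE => S1D A1S.
set A1 := fun S => c0 (i |: S).
have A1st : mastable A1 D'.
  apply: (IH D' A1 (fun S => c1 (i |: S)) Dn); last by exists S1.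
  move=> e e0; pose m := normc (c0 (i |: S1)); pose b := normc (c1 (i |: S1)).
  have m0 : 0 < m by rewrite normc_gt0.
  have b0 : 0 <= b := normc_ge0 _.
  (* For [x] this small the perturbed leading part keeps a nonzero coefficient at [S1], as the inner
     limit requires. *)
  have e'0 : 0 < Num.min e (m / (b + 1)).
    by rewrite lt_min e0 divr_gt0 //; lra.
  have [x] := limU _ e'0; rewrite lt_min => /andP[xe xm] st; exists x => //.
  apply: (IH D' _ (fun S => c0 S + x * c1 S) Dn); last first.
    exists S1 => //; apply: normcD_neq0; rewrite ComplexField.Normc.normcM -/b -/m.
    move: xm; rewrite ltr_pdivlMr; last lra.
    by apply: le_lt_trans; apply: ler_wpM2l; [exact: normc_ge0|lra].
  (* With the [i]-th variable at [- s^-1], multiplication by [- s] leaves the leading part plus a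
     perturbation that is linear in the small number [s]. *)
  move=> e1 /half_plane_small[s s0 se]; exists (- s); first by rewrite normcN.
  have t0 : 0 < Im (- s^-1) by rewrite ImN oppr_gt0 ImV_lt0.
  have sn0 := Im_gt0_neq0 s0.
  have ns0 : - s != 0 by rewrite oppr_eq0.
  apply: eq_mastable (mastableZ ns0 (st _ t0)) => S' _.
  by rewrite /A1; field.
have a1n0 := A1st z z0.
apply/negP => /eqP root0.
set a0 := maff c0 D' z in root0; set a1 := maff A1 D' z in root0 a1n0.
pose b0 := maff c1 D' z; pose b1 := maff (fun S => c1 (i |: S)) D' z.
set t := z i in root0; pose b := b0 + t * b1.
have a1p : 0 < normc a1 by rewrite normc_gt0.
have b1p : 0 <= normc b1 := normc_ge0 _.
have bp : 0 <= normc b := normc_ge0 _.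
have tp : 0 < Im t := z0 i.
(* The first bound keeps the perturbed leading coefficient at least half as large as [a1]; the
   second keeps the displacement of the root below [Im t]. *)
pose e := Num.min (normc a1 / (2 * (normc b1 + 1)))
                  (Im t * normc a1 / (2 * (normc b + 1))).
have e0 : 0 < e.
  by rewrite lt_min !divr_gt0 ?mulr_gt0 //; lra.
have [x] := limU e e0; rewrite lt_min => /andP[xb1 xb] st.
have xp : 0 <= normc x := normc_ge0 _.
move: xb1 xb; rewrite !ltr_pdivlMr; try lra.
move=> xb1 xb.
have dp : normc a1 / 2 <= normc (a1 + x * b1).
  have := le_normcD (a1 + x * b1) (- (x * b1)).
  rewrite addrK normcN ComplexField.Normc.normcM; nra.
have d0 : a1 + x * b1 != 0 by rewrite -normc_gt0; lra.
(* [t + u] is the root of the perturbed affine function, still in the open upper half-plane, which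
   contradicts its stability. *)
pose u := - (x * b) / (a1 + x * b1).
have ut : normc u < Im t.
  rewrite ComplexField.Normc.normcM ComplexField.Normc.normcV normcN.
  rewrite ComplexField.Normc.normcM ltr_pdivrMr ?normc_gt0 //; nra.
have := st _ (Im_perturb ut) z z0; rewrite !maffDZ -/a0 -/b0 -/A1 -/a1 -/b1.
case/negP; apply/eqP.
have -> : a0 = - (t * a1) by apply/eqP; rewrite -addr_eq0 root0.
rewrite /u /b; field; exact: d0.
Qed.

Lemma hurwitz0 D c0 c1 :
  (forall x, 0 < Im x -> mastable (fun S => c0 S + x * c1 S) D) ->
  (exists2 S : {set T}, S \subset D & c0 S != 0) ->
  mastable c0 D.
Proof.
move=> st; apply: hurwitz => e /half_plane_small[x x0 xe].
by exists x; last exact: st.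
Qed.

(** The limit where the extra variable tends to infinity: put it at [- x^-1] with [x] small and
    multiply by [- x]. *)
Lemma hurwitz_infty D c0 c1 :
  (forall x, 0 < Im x -> mastable (fun S => c0 S + x * c1 S) D) ->
  (exists2 S : {set T}, S \subset D & c1 S != 0) ->
  mastable c1 D.
Proof.
move=> st; apply: (@hurwitz _ _ c0) => e /half_plane_small[x x0 xe].
exists (- x); first by rewrite normcN.
have t0 : 0 < Im (- x^-1) by rewrite ImN oppr_gt0 ImV_lt0.
have xn0 := Im_gt0_neq0 x0.
have nx0 : - x != 0 by rewrite oppr_eq0.
apply: eq_mastable (mastableZ nx0 (st _ t0)) => S' _.
by field.
Qed.

Lemma root_Im_ge0 (p q : R[i]) : q != 0 ->
  (forall x, 0 < Im x -> p + x * q != 0) -> 0 <= Im (p / q).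
Proof.
move=> q0 H; rewrite leNgt; apply/negP => pq.
have := H (- (p / q)); rewrite ImN oppr_gt0 => /(_ pq)/negP; apply.
by apply/eqP; field.
Qed.

(* The Lieb-Sokal argument: where [d != 0], the quotient
   [(a + x * b) / (c + x * d)] lies in the closed upper half-plane, while
   [d / (c + x * d) = 1 / (x + c / d)] lies in the open lower one. *)
Lemma lieb_sokal i j D c : i != j -> i \notin D -> j \notin D ->
  mastable c (i |: (j |: D)) ->
  (exists2 S : {set T}, S \subset D & c S - c (i |: (j |: S)) != 0) ->
  mastable (fun S => c S - c (i |: (j |: S))) D.
Proof.
move=> ij iD jD st [S SD ad].
have jiD : j \notin i |: D by rewrite in_setU1 negb_or eq_sym ij.
have st1 y : 0 < Im y -> mastable (fun S => c S + y * c (j |: S)) (i |: D).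
  by move: y; apply/mastableU1 => //; rewrite setUCA.
have SDi : i |: S \subset i |: D by apply: setUS.
(* If [d] vanishes identically, the difference is [c] itself, and both variables can be sent to
   0. *)
case: (boolP [exists S in powerset D, c (i |: (j |: S)) != 0]); last first.
  move=> /exists_inPn d0.
  have dE (S' : {set T}) : S' \subset D -> c (i |: (j |: S')) = 0.
    by move=> S'D; apply/eqP; have := d0 S'; rewrite powersetE S'D negbK; apply.
  rewrite dE // subr0 in ad.
  apply: (@eq_mastable c) => [S' /dE ->|]; first by rewrite subr0.
  apply: (@hurwitz0 _ _ (fun S => c (i |: S))); last by exists S.
  apply/mastableU1 => //; apply: (hurwitz0 st1).
  by exists S => //; rewrite subsetU // SD orbT.
move=> /exists_inP[S1]; rewrite powersetE => S1D d0.
have Qst : forall x, 0 < Im x ->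
    mastable (fun S => c (j |: S) + x * c (i |: (j |: S))) D.
  have : mastable (fun S => c (j |: S)) (i |: D).
    apply: (hurwitz_infty st1); exists (i |: S1); first exact: setUS.
    by rewrite setUCA.
  move=> /(mastableU1 _ iD) H x /H; apply: eq_mastable => S' _.
  by rewrite (setUCA [set j]).
have dst : mastable (fun S => c (i |: (j |: S))) D.
  by apply: (hurwitz_infty Qst); exists S1.
(* It suffices to treat [a - d + x * b] with [x] in the open half-plane: a root gives
   [a + x * b = d], which makes the two quotients coincide. *)
apply: (@hurwitz0 _ _ (fun S => c (i |: S))); last by exists S.
move=> x x0 z z0.
pose a := maff c D z; pose b := maff (fun S => c (i |: S)) D z.
pose cc := maff (fun S => c (j |: S)) D z.
pose d := maff (fun S => c (i |: (j |: S))) D z.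
have dn0 : d != 0 by exact: dst.
have qn0 t : 0 < Im t -> cc + t * d != 0.
  by move=> t0; rewrite -maffDZ; exact: Qst.
have pn0 y : 0 < Im y -> (a + x * b) + y * (cc + x * d) != 0.
  move=> y0; move/(mastableU1 _ iD)/(_ x x0 z z0): (st1 y y0); rewrite !maffDZ.
  rewrite -/a -/b -/cc.
  rewrite (@eq_maff _ _ (fun S => c (j |: (i |: S))) (fun S => c (i |: (j |: S))) D z z) //.
    rewrite -/d; congr (_ != 0); ring.
  by move=> S' _; rewrite setUCA.
have cd0 : 0 <= Im (cc / d) by exact: root_Im_ge0.
have pq0 := root_Im_ge0 (qn0 x x0) pn0.
rewrite maffDZ -/b.
have -> : maff (fun S => c S - c (i |: (j |: S))) D z = a - d.
  rewrite /a /d -mulN1r -maffDZ; apply: eq_maff => // S' _; ring.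
apply/negP => /eqP e0.
have e1 : a + x * b = d by apply/eqP; rewrite -subr_eq0 -e0; apply/eqP; ring.
move: pq0; rewrite e1.
have -> : d / (cc + x * d) = (x + cc / d)^-1.
  by rewrite -invf_div; congr _^-1; field.
rewrite leNgt ImV_lt0 // ImD; lra.
Qed.

End Stability.

(** * A correlation inequality for stable polynomials with signs *)

Section Rayleigh.
Variables (R : rcfType) (T : finType).
Implicit Types (k : {set T} -> R) (D S : {set T}) (x sg : T -> R).

(** The coefficients after the substitution of [sg g * x g] for every variable; for [sg := esign]
    this is the sign flip of Bi-Stability. *)
Definition signed sg k S : R[i] := real_complex R ((\prod_(g in S) sg g) * k S).

(* Real specializations of stable polynomials reduce the claim to the
   criterion for bivariate multiaffine polynomials. *)
Lemma rayleigh i j D sg k x :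
  i != j -> i \notin D -> j \notin D -> sg i = 1 -> sg j = -1 ->
  (forall g, sg g ^+ 2 = 1) ->
  (forall S : {set T}, S \subset i |: (j |: D) -> 0 < k S) ->
  mastable (signed sg k) (i |: (j |: D)) ->
  {in D, forall g, 0 < x g} ->
  maff (fun S => k (i |: S)) D x * maff (fun S => k (j |: S)) D x <=
  maff k D x * maff (fun S => k (i |: (j |: S))) D x.
Proof.
move=> ij + + sgi sgj sg2.
have [n] := ubnP #|D|; elim: n D k => // n IH D k.
case: (set_0Vmem D) => [-> _ _ _ k0 st _|[g gD]].
  rewrite !maff_set0 leNgt; apply/negP => H.
  move: st => /mastableU1; rewrite !inE orbF => /(_ ij) st.
  have H1 : 0 < complex.Im (Complex 0 1 : R[i]) by rewrite /= ltr01.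
  have /mastableU1 := st _ H1; rewrite inE => /(_ isT) st1.
  pose a := k set0; pose b := k (i |: set0); pose cc := k (j |: set0).
  pose d := k (i |: (j |: set0)).
  have kk (S : {set T}) : S \subset i |: (j |: set0) -> 0 < k S by exact: k0.
  have a0 : 0 < a by apply: kk; rewrite sub0set.
  have b0 : 0 < b by apply: kk; rewrite setUS ?sub0set.
  have cc0 : 0 < cc by apply: kk; rewrite subsetUr.
  have d0 : 0 < d by apply: kk.
  rewrite -/a -/b -/cc -/d in H.
  pose m := cc ^+ 2 + d ^+ 2.
  have m0 : 0 < m by rewrite addr_gt0 ?exprn_gt0.
  (* This [y] solves [a + b * z - cc * y - d * z * y = 0] at [z] the imaginary unit; its imaginary
     part is positive exactly when the claim fails. *)
  pose y : R[i] := Complex ((a * cc + b * d) / m) ((b * cc - a * d) / m).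
  have y0 : 0 < complex.Im y by rewrite /= divr_gt0 // subr_gt0.
  have := st1 y y0 (fun=> y) (fun=> y0); rewrite maff_set0 /signed.
  rewrite !big_setU1 ?inE ?orbF //= !big_set0 sgi sgj -/a -/b -/cc -/d.
  case/negP; apply/eqP/eqP; rewrite eq_complex /=.
  by apply/andP; split; apply/eqP; rewrite /m; field; rewrite -/m gt_eqF.
rewrite -(setD1K gD) cardsU1 setD11 /= add1n ltnS; set D' := D :\ g => Dn.
have gD' : g \notin D' by rewrite setD11.
rewrite !in_setU1 !negb_or => /andP[ig iD'] /andP[jg jD'] k0 st x0.
(* The variable [g] is specialized at the positive real value [x g]. *)
pose k' S := k S + x g * k (g |: S).
have xg0 : 0 < x g by apply: x0; rewrite setU11.
have gij : g \notin i |: (j |: D').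
  by rewrite !in_setU1 !negb_or gD' eq_sym ig eq_sym jg.
have DE : i |: (j |: (g |: D')) = g |: (i |: (j |: D')).
  by rewrite (setUCA [set j]) setUCA.
rewrite DE in k0 st.
have k'0 (S : {set T}) : S \subset i |: (j |: D') -> 0 < k' S.
  move=> SD; rewrite addr_gt0 ?mulr_gt0 //; apply: k0; last exact: setUS.
  by rewrite subsetU // SD orbT.
have /(IH D' k' Dn iD' jD' k'0) : mastable (signed sg k') (i |: (j |: D')).
  (* In the signed polynomial the real point is [sg g * x g], since the sign squares to 1; it is a
     limit of points of the open half-plane. *)
  apply: (@hurwitz0 _ _ _ _ (fun S => signed sg k (g |: S))); last first.
    exists set0; first exact: sub0set.
    rewrite /signed big_set0 mul1r fmorph_eq0 gt_eqF //.
    by apply: k'0; rewrite sub0set.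
  move=> t t0.
  have t1 : 0 < complex.Im (real_complex R (sg g * x g) + t) by rewrite ImD /= add0r.
  move/(mastableU1 _ gij)/(_ _ t1): st; apply: eq_mastable => S SD.
  have gS : g \notin S by apply: contra gij; apply: (subsetP SD).
  rewrite /signed big_setU1 //= mulrDl addrA; congr (_ + _).
  rewrite -rmorphM -rmorphD /=; congr (real_complex R _).
  rewrite /k' mulrDr; congr (_ + _).
  by set P := \prod_(_ in _) _; rewrite -[RHS]mul1r -(sg2 g); ring.
have x0' : {in D', forall g, 0 < x g}.
  by move=> h hD; apply: x0; rewrite in_setU1 hD orbT.
move=> /(_ x0').
have E (F : {set T} -> {set T}) : (forall S, g |: F S = F (g |: S)) ->
    maff (fun S => k' (F S)) D' x = maff (fun S => k (F S)) (g |: D') x.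
  move=> FE; rewrite maff_setU1 // maffD maffZ; congr (_ + _ * _).
  by apply: eq_maff => // S _; rewrite FE.
rewrite (E id) // (E (fun S => i |: S)); last by move=> S; rewrite setUCA.
rewrite (E (fun S => j |: S)); last by move=> S; rewrite setUCA.
rewrite (E (fun S => i |: (j |: S))) // => S.
by rewrite setUCA (setUCA [set g]).
Qed.

End Rayleigh.

(** * Contraction of an edge *)

Section Models.
Variables (R : realType) (V E : finType).
Implicit Types (G : multiGM R V E) (a : V) (al : E) (S s : {set E * bool}).

Definition wf G : Prop := {in dedges G, forall g, attach G g \in nodes G}.

Definition weight G S : R := \prod_(a in nodes G) factor G a (S :&: dedges_at G a).

Definition esign (g : E * bool) : R := if g.2 then 1 else -1.

Lemma esign_sqr g : esign g ^+ 2 = 1.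
Proof. by rewrite /esign; case: ifP => _; rewrite ?sqrrN expr1n. Qed.

(** The morphism is the embedding into the complex numbers for stability, and the identity for the
    dual of the Bethe free energy. *)
Lemma prod_node_maff (K : comNzRingType) (phi : {rmorphism R -> K}) G x :
  wf G ->
  \prod_(a in nodes G) maff (fun s => phi (factor G a s)) (dedges_at G a) x =
  maff (fun S => phi (weight G S)) (dedges G) x.
Proof.
move=> wfG; rewrite (maff_prod (fun a s => phi (factor G a s)) x wfG).
by apply: eq_maff => // S _; rewrite rmorph_prod.
Qed.

(** * From multivariate polynomials to families of coefficients *)

Section Polynomials.
Import mpoly.

Lemma meval_flip_gm_poly G (z : E * bool -> R[i]) : wf G ->
  (map_mpoly (real_complex R) (flip_reverse (gm_poly G))).@[
    fun i => z (enum_val i)] = maff (signed esign (weight G)) (dedges G) z.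
Proof.
move=> wfG; rewrite /signed.
rewrite (@eq_maff _ _ _ (fun S => (\prod_(g in S) real_complex R (esign g)) *
  real_complex R (weight G S)) _ z z) // => [|S _]; last first.
  by rewrite rmorphM rmorph_prod.
rewrite -maff_scale -(prod_node_maff (real_complex R)) //.
rewrite /flip_reverse /gm_poly 3!rmorph_prod /=.
apply: eq_bigr => a _; rewrite /node_poly. rewrite (raddf_sum (comp_mpoly _)) (raddf_sum (map_mpoly _)) (raddf_sum (meval _)) /=.
apply: eq_bigr => s; rewrite powersetE => sD.
rewrite comp_mpolyZ map_mpolyZ mevalZ 3!rmorph_prod /=; congr (_ * _).
have sE : s = [set g in dedges G | g \in s].
  apply/setP => g; rewrite !inE andb_idl // => /(subsetP sD).
  by rewrite !inE => /andP[].
rewrite [in RHS]sE (eq_bigl (fun g => (g \in dedges G) && (g \in s))); last first.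
  by move=> g; rewrite !inE.
rewrite big_enum_val_cond /=; apply: eq_bigr => i _.
rewrite comp_mpolyXU -tnth_nth tnth_mktuple /esign.
case: ifP => _; first by rewrite map_mpolyX mevalXU rmorph1 mul1r.
by rewrite !rmorphN /= map_mpolyX mevalXU rmorph1 mulN1r.
Qed.

Lemma bi_stableE G : wf G ->
  bi_stable (gm_poly G) <-> mastable (signed esign (weight G)) (dedges G).
Proof.
move=> wfG; split => [[_ st] z z0|st].
  by rewrite -meval_flip_gm_poly //; apply: st => i; exact: z0.
have H1 : 0 < complex.Im (Complex 0 1 : R[i]) by rewrite /= ltr01.
split => [|z z0].
  have := st (fun=> Complex 0 1) (fun=> H1); rewrite -meval_flip_gm_poly //.
  by apply: contraNneq => ->; rewrite !rmorph0.
(* [mastable] evaluates at points defined on all directed edges; absent ones get the imaginary unit,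
   to remain in the half-plane. *)
pose z' g := if [pick i | enum_val i == g] is Some i then z i else Complex 0 1.
have := st z'; rewrite -meval_flip_gm_poly //.
have z'E i : z' (enum_val i) = z i.
  rewrite /z'; case: pickP => [j /eqP/enum_val_inj -> //|/(_ i)].
  by rewrite eqxx.
rewrite (meval_eq _ z'E).
by apply=> g; rewrite /z'; case: pickP.
Qed.

End Polynomials.

Lemma edges_contract G al : edges (contract G al) = edges G :\ al.
Proof. by []. Qed.

Section Contract.
Variables (G : multiGM R V E) (al : E).
Hypotheses (wfG : wf G) (alG : al \in edges G).
Let G' := contract G al.
Let b := attach G (primary al).
Let c := attach G (reverse al).

Lemma dedges_contract : dedges G = primary al |: (reverse al |: dedges G').
Proof.
apply/setP => -[e d]; rewrite !inE /= /primary /reverse !xpair_eqE.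
by case: eqP => [->|_] /=; case: d; rewrite ?andbF ?orbT ?alG.
Qed.

Lemma primary_contract : primary al \notin dedges G'.
Proof. by rewrite !inE /= eqxx. Qed.

Lemma reverse_contract : reverse al \notin dedges G'.
Proof. by rewrite !inE /= eqxx. Qed.

Lemma dedges_contract_sub : dedges G' \subset dedges G.
Proof. by rewrite dedges_contract setUA subsetUr. Qed.

Lemma primary_dedges : primary al \in dedges G.
Proof. by rewrite inE. Qed.

Lemma reverse_dedges : reverse al \in dedges G.
Proof. by rewrite inE. Qed.

Lemma wf_contract : wf G'.
Proof.
move=> g gD; have gG := wfG (subsetP dedges_contract_sub g gD).
have bG : b \in nodes G by apply/wfG/primary_dedges.
rewrite /G' /contract /= -/b -/c.
case: (eqVneq b c) => [bc|bc]; first by case: ifP.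
by rewrite !inE; case: (eqVneq (attach G g) c) => [_|gc]; rewrite ?bc ?gc ?bG ?gG.
Qed.

Lemma dedges_at_contract a : a != b -> a != c ->
  dedges_at G' a = dedges_at G a.
Proof.
move=> ab ac; apply/setP => -[e d]; rewrite !inE /= -/b -/c -andbA.
have -> : ((if attach G (e, d) == c then b else attach G (e, d)) == a) =
    (attach G (e, d) == a).
  case: (attach G (e, d) =P c) => // ->; rewrite [LHS]eq_sym [RHS]eq_sym.
  by rewrite (negbTE ab) (negbTE ac).
case: (eqVneq e al) => //= ->; apply/esym/negbTE; rewrite negb_and orbC.
by case: d; rewrite -/(primary al) -/(reverse al) -/b -/c eq_sym ?ab ?ac.
Qed.

(** Only the factors at the end nodes [b] and [c] change; the product [rest] over the other nodes is
    common to all three weights. *)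
Lemma weight_contract S : S \subset dedges G' ->
  weight G' S = weight G S + weight G (primary al |: (reverse al |: S)).
Proof.
move=> SD.
have bG : b \in nodes G by apply/wfG/primary_dedges.
have cG : c \in nodes G by apply/wfG/reverse_dedges.
have bG' : b \in nodes G'.
  rewrite /G' /contract /= -/b -/c.
  by case: (eqVneq b c) => // bc; rewrite !inE bc bG.
have pS : primary al \notin S by apply: contra primary_contract; apply: (subsetP SD).
have rS : reverse al \notin S by apply: contra reverse_contract; apply: (subsetP SD).
set X := primary al |: (reverse al |: S).
have XE a : a != b -> a != c -> X :&: dedges_at G a = S :&: dedges_at G a.
  move=> ab ac; rewrite /X; apply/setP => g; rewrite !in_setI !in_setU1.
  rewrite andb_orl orbC andb_orl orbC.
  have -> : (g == primary al) && (g \in dedges_at G a) = false.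
    by apply/negbTE/negP => /andP[/eqP ->]; rewrite inE -/b eq_sym (negbTE ab) andbF.
  have -> // : (g == reverse al) && (g \in dedges_at G a) = false.
  by apply/negbTE/negP => /andP[/eqP ->]; rewrite inE -/c eq_sym (negbTE ac) andbF.
have restE : \prod_(a in nodes G' | a != b) factor G' a (S :&: dedges_at G' a) =
    \prod_(a in nodes G | (a != b) && (a != c)) factor G a (S :&: dedges_at G a).
  apply: eq_big => a.
    rewrite /G' /contract /= -/b -/c; case: (eqVneq b c) => [<-|bc].
      by rewrite andbb.
    by rewrite !inE andbC [RHS]andbC; case: (a != b).
  move=> /andP[aG' ab]; rewrite {1}/G' /contract /= -/b -/c ab.
  rewrite dedges_at_contract //.
  move: aG'; rewrite /G' /contract /= -/b -/c; case: (eqVneq b c) => [<- //|_].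
  by rewrite !inE => /andP[].
pose rest Y := \prod_(a in nodes G | (a != b) && (a != c))
  factor G a (Y :&: dedges_at G a).
have restX : rest X = rest S.
  by apply: eq_bigr => a /and3P[_ ab ac]; rewrite XE.
rewrite {1}/weight (bigD1 b) //= restE -/(rest S).
rewrite {1}/G' /contract /= -/b -/c eqxx /=.
have [bc|bc] := eqVneq b c.
  have weightE Y : weight G Y = factor G b (Y :&: dedges_at G b) * rest Y.
    rewrite /weight (bigD1 b) //=; congr (_ * _); apply: eq_bigl => a.
    by rewrite -bc andbb.
  rewrite !weightE restX -mulrDl; congr (_ * _); rewrite big_bool addrC /=.
  have SE : S :&: dedges_at G' b = S :&: dedges_at G b.
    apply/setP => g; rewrite !inE /= -/b -/c -bc.
    case gS: (g \in S) => //=; have := subsetP SD g gS; rewrite !inE => /andP[-> ->] /=.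
    by case: (eqVneq (attach G g) b) => [_|/negbTE]; rewrite ?eqxx.
  rewrite -/G' SE; congr (_ + _); congr (factor G b _).
  apply/setP => g; rewrite !inE; case: (eqVneq g (primary al)) => [->|_] /=.
    by rewrite orbT alG -/b eqxx.
  case: (eqVneq g (reverse al)) => [->|_] /=; last by rewrite orbF.
  by rewrite orbT alG -/c -bc eqxx.
have weightE Y : weight G Y = factor G b (Y :&: dedges_at G b) *
    factor G c (Y :&: dedges_at G c) * rest Y.
  rewrite /weight (bigD1 b) //= (bigD1 c) ?cG 1?eq_sym //= mulrA; congr (_ * _).
  by apply: eq_bigl => a; rewrite -andbA.
rewrite !weightE restX -mulrDl; congr (_ * _); rewrite big_bool addrC /=.
(* The merged node carries every directed edge of [S] attached to [b] or [c], so restricting to it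
   first loses nothing. *)
have SE a : (a == b) || (a == c) ->
    S :&: dedges_at G' b :&: dedges_at G a = S :&: dedges_at G a.
  move=> abc; apply/setP => g; rewrite !inE /= -/b -/c.
  case gS: (g \in S) => //=; have := subsetP SD g gS; rewrite !inE => /andP[-> ->] /=.
  case: (eqVneq (attach G g) a) => [->|_]; rewrite ?andbT ?andbF //.
  by case/orP: abc => [/eqP ->|->]; rewrite ?eqxx // (negbTE bc) eqxx.
rewrite -/G' !SE ?eqxx ?orbT //; congr (_ + _).
congr (factor G _ _ * factor G _ _).
  apply/setP => g; rewrite !inE; case: (eqVneq g (primary al)) => [->|_] /=.
    by rewrite orbT alG -/b eqxx.
  case: (eqVneq g (reverse al)) => [->|_] /=; rewrite orbF //.
  by rewrite -/c eq_sym (negbTE bc) !andbF.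
apply/setP => g; rewrite !inE; case: (eqVneq g (reverse al)) => [->|_] /=.
  by rewrite !orbT alG -/c eqxx.
case: (eqVneq g (primary al)) => [->|_] /=; rewrite orbF //.
by rewrite -/b (negbTE bc) !andbF.
Qed.

(** A configuration of undirected edges becomes a set of directed edges closed under reversal: only
    such monomials enter the partition function. *)
Lemma partition_functionE (H : multiGM R V E) :
  partition_function H =
  \sum_(sigma in powerset (edges H)) weight H [set g | g.1 \in sigma].
Proof.
apply: eq_bigr => sigma _; apply: eq_bigr => a _; congr (factor H a _).
by apply/setP => g; rewrite !inE andbC.
Qed.

(** Split the configurations by their value on [al]: the value 1 adds both directed versions, as in
    the second term of [weight_contract]. *)
Lemma partition_function_contract : partition_function G' = partition_function G.
Proof.
rewrite !partition_functionE edges_contract -[in RHS](setD1K alG).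
rewrite big_powersetU1 ?setD11 // -big_split; apply: eq_bigr => sigma.
rewrite powersetE => sigmaD; rewrite weight_contract.
  congr (_ + weight G _); apply/setP => -[e d].
  rewrite !inE /= /primary /reverse !xpair_eqE.
  by case: d; rewrite ?andbT ?andbF ?orbF.
by apply/subsetP => g; rewrite inE => /(subsetP sigmaD); rewrite !inE.
Qed.

Lemma soft_weight_gt0 (H : multiGM R V E) S : soft H -> 0 < weight H S.
Proof.
by move=> sH; apply: prodr_gt0 => a aH; apply: sH => //; rewrite powersetE subsetIr.
Qed.

Lemma soft_contract : soft G -> soft G'.
Proof.
move=> sG.
have bG : b \in nodes G by apply/wfG/primary_dedges.
have cG : c \in nodes G by apply/wfG/reverse_dedges.
move=> a s aG'; rewrite powersetE => sD /=; rewrite -/b -/c.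
have [ab|ab] := eqVneq a b; last first.
  have aG : a \in nodes G.
    by move: aG'; rewrite /= -/b -/c; case: ifP => // _; rewrite inE => /andP[].
  have ac : a != c.
    move: aG'; rewrite /= -/b -/c; case: eqP => [<- //|_].
    by rewrite !inE => /andP[].
  by apply: sG => //; rewrite powersetE -dedges_at_contract.
have pD : primary al \in dedges_at G b by rewrite !inE alG -/b eqxx.
have rD : reverse al \in dedges_at G c by rewrite !inE alG -/c eqxx.
have [bc|bc] /= := eqVneq b c.
  have sb : s \subset dedges_at G b.
    apply: subset_trans sD _; apply/subsetP => g; rewrite !inE /= -/b -/c -bc ab.
    case: (eqVneq (attach G g) b) => [_|gb] /andP[/andP[_ ->]] //=.
    by rewrite (negbTE gb).
  rewrite big_bool addr_gt0 //=; apply: sG => //; rewrite powersetE //.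
  by rewrite subUset sb subUset !sub1set pD bc rD.
rewrite big_bool addr_gt0 //= mulr_gt0 //; apply: sG => //; rewrite powersetE;
  by rewrite ?subUset ?sub1set ?pD ?rD ?subsetIr.
Qed.

Lemma bi_stable_contract : soft G ->
  mastable (signed esign (weight G)) (dedges G) ->
  mastable (signed esign (weight G')) (dedges G').
Proof.
move=> sG; rewrite {1}dedges_contract => st.
have pr : primary al != reverse al by rewrite /primary /reverse xpair_eqE andbF.
have sgnE S : S \subset dedges G' ->
    signed esign (weight G) S -
      signed esign (weight G) (primary al |: (reverse al |: S)) =
    signed esign (weight G') S.
  move=> SD; rewrite /signed weight_contract //.
  have rS : reverse al \notin S.
    by apply: contra reverse_contract; apply: (subsetP SD).
  have pS : primary al \notin reverse al |: S.
    rewrite in_setU1 negb_or pr.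
    by apply: contra primary_contract; apply: (subsetP SD).
  rewrite big_setU1 //= big_setU1 //= -rmorphB /= {2 3}/esign /=.
  by congr (real_complex R _); ring.
apply: (eq_mastable sgnE).
apply: lieb_sokal pr primary_contract reverse_contract st _.
(* Lieb-Sokal needs some nonzero coefficient; by softness the constant one is positive. *)
exists set0; first exact: sub0set.
rewrite sgnE ?sub0set // /signed big_set0 mul1r fmorph_eq0 gt_eqF //.
exact/soft_weight_gt0/soft_contract.
Qed.


End Contract.
End Models.
(** * Gibbs distributions *)

Section Entropy.
Variable R : realType.

Lemma ln_le_subr1 (x : R) : 0 < x -> ln x <= x - 1.
Proof. by move=> x0; have := @le_ln1Dx R (x - 1); rewrite (addrC 1) subrK; apply; lra. Qed.

(** The log-sum inequality, by the tangent bound [ln y <= y - 1] at [y = (B / W) / (b i / w i)]; the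
    corrections [b i - w i * (B / W)] sum to 0. *)
Lemma log_sum (I : finType) (P : pred I) (b w : I -> R) :
  (forall i, P i -> 0 <= b i) -> (forall i, P i -> 0 < w i) ->
  0 < \sum_(i | P i) b i ->
  (\sum_(i | P i) b i) * ln ((\sum_(i | P i) b i) / \sum_(i | P i) w i) <=
  \sum_(i | P i) b i * ln (b i / w i).
Proof.
move=> b0 w0; set B := \sum_(i | P i) b i => B0; set W := \sum_(i | P i) w i.
have W0 : 0 < W.
  case: (pickP P) => [i Pi|P0]; last by move: B0; rewrite /B big_pred0 // ltxx.
  rewrite /W (bigD1 i) //=; apply: ltr_pwDl; first exact: w0.
  by apply: sumr_ge0 => j /andP[Pj _]; exact/ltW/w0.
have -> : B * ln (B / W) = \sum_(i | P i) (b i * ln (B / W) + b i - w i * (B / W)).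
  rewrite sumrB big_split /= -!mulr_suml -/B -/W mulrCA divff ?gt_eqF //.
  by rewrite mulr1 addrK.
apply: ler_sum => i Pi.
have BW : 0 < B / W by rewrite divr_gt0.
have wi := w0 i Pi; have := b0 i Pi; rewrite le_eqVlt => /predU1P[<-|bi].
  by rewrite !mul0r !add0r oppr_le0 mulr_ge0 // ltW.
have bw : 0 < b i / w i by rewrite divr_gt0.
have H := ln_le_subr1 (divr_gt0 BW bw); rewrite ln_div ?posrE // in H.
have := ler_wpM2l (ltW bi) H.
have -> : b i * (B / W / (b i / w i) - 1) = w i * (B / W) - b i.
  by field; rewrite !gt_eqF.
by rewrite mulrBr => ?; lra.
Qed.

Lemma ln_prod_gt0 (I : finType) (A : {set I}) (x : I -> R) :
  {in A, forall i, 0 < x i} -> ln (\prod_(i in A) x i) = \sum_(i in A) ln (x i).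
Proof.
move=> x0.
suff [] : 0 < \prod_(i in A) x i /\ ln (\prod_(i in A) x i) = \sum_(i in A) ln (x i) by [].
elim/big_rec2: _ => [|i y p iA [p0 <-]]; first by rewrite ltr01 ln1.
by rewrite mulr_gt0 ?x0 // lnM ?posrE ?x0.
Qed.

(* The witnesses make the two mixed terms at most [r * a], where
   [r = t / (1 - t)], so that the left-hand logarithm is at most
   [ln (a / (1 - t) ^+ 2)]. *)
Lemma bivariate_bound (a b c d t : R) :
  0 < a -> 0 < b -> 0 < c -> 0 < d -> c * d <= a * b -> 0 < t < 1 ->
  exists xy : R * R, [/\ 0 < xy.1, 0 < xy.2 &
    ln (a + xy.1 * c + xy.2 * d + xy.1 * xy.2 * b) <=
    ln (a + b) + t * (ln xy.1 + ln xy.2) - (t * ln t + (1 - t) * ln (1 - t))].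
Proof.
move=> a0 b0 c0 d0 cd /andP[t0 t1].
have s0 : 0 < 1 - t by lra.
pose r := t / (1 - t); have r0 : 0 < r by rewrite divr_gt0.
(* The term in [c] becomes [r * a] and the term in [b] becomes [r * r * a]; the hypothesis bounds
   the term in [d] by [r * a], and [1 + r = (1 - t)^-1]. *)
exists (r * a / c, r * c / b); split => /=; try by rewrite divr_gt0 // mulr_gt0.
have le : a + r * a / c * c + r * c / b * d + r * a / c * (r * c / b) * b <=
    a / (1 - t) ^+ 2.
  have -> : a / (1 - t) ^+ 2 = a + r * a + r * a + r * r * a.
    by rewrite /r; field; rewrite gt_eqF.
  have -> : r * a / c * c = r * a by field; rewrite gt_eqF.
  have -> : r * a / c * (r * c / b) * b = r * r * a by field; rewrite !gt_eqF.
  have : r * c / b * d <= r * a.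
    have -> : r * c / b * d = r * (c * d) / b by field; rewrite gt_eqF.
    by rewrite ler_pdivrMr // -(mulrA r a) ler_wpM2l // ltW.
  lra.
have lhs0 : 0 < a + r * a / c * c + r * c / b * d + r * a / c * (r * c / b) * b.
  by rewrite !addr_gt0 // ?mulr_gt0 ?invr_gt0 // !mulr_gt0 ?invr_gt0.
have rhs0 : 0 < a / (1 - t) ^+ 2 by rewrite divr_gt0 ?exprn_gt0.
apply: (le_trans (y := ln (a / (1 - t) ^+ 2))); first by rewrite ler_ln ?posrE.
(* What remains is the log-sum inequality on two points, with probabilities [1 - t], [t] and weights
   [a], [b]. *)
have := @log_sum bool predT (fun u => if u then t else 1 - t)
  (fun u => if u then b else a).
rewrite !big_bool /= [t + (1 - t)]addrC subrK mul1r div1r.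
move=> /(_ _ _ ltr01) => H; have {H} : ln (b + a)^-1 <=
    t * ln (t / b) + (1 - t) * ln ((1 - t) / a).
  by apply: H; case=> _ //; exact: ltW.
rewrite lnV ?posrE ?addr_gt0 //.
have lnD (u v : R) : 0 < u -> 0 < v -> ln (u / v) = ln u - ln v.
  by move=> u0 v0; rewrite ln_div ?posrE.
rewrite !lnD ?exprn_gt0 ?mulr_gt0 ?invr_gt0 // expr2 !lnM ?posrE ?invr_gt0 //.
by rewrite lnV ?posrE // (addrC b); lra.
Qed.

End Entropy.

Section Gibbs.
Variables (R : realType) (T : finType).
Implicit Types (D S : {set T}) (f b : {set T} -> R) (x mu : T -> R).

Lemma sum_powerset_exchange D (F : {set T} -> T -> R) :
  \sum_(S in powerset D) \sum_(g in S) F S g =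
  \sum_(g in D) \sum_(S in powerset D | g \in S) F S g.
Proof.
apply: exchange_big_dep => S g /=; rewrite powersetE => /subsetP; exact.
Qed.

(** Weak duality: the log-sum inequality against the weights [f S * \prod_(g in S) x g], in which
    the gauge enters only through the marginals of [b]. *)
Lemma gibbs_le D b f mu x :
  (forall S, S \in powerset D -> 0 <= b S) ->
  \sum_(S in powerset D) b S = 1 ->
  {in D, forall g, \sum_(S in powerset D | g \in S) b S = mu g} ->
  (forall S, S \in powerset D -> 0 < f S) ->
  {in D, forall g, 0 < x g} ->
  \sum_(g in D) mu g * ln (x g) - ln (maff f D x) <=
  \sum_(S in powerset D) b S * ln (b S / f S).
Proof.
move=> b0 b1 bmu f0 x0.
have xS S : S \in powerset D -> {in S, forall g, 0 < x g}.
  by rewrite powersetE => SD g gS; apply/x0/(subsetP SD).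
have px S : S \in powerset D -> 0 < \prod_(g in S) x g.
  by move=> /xS xS'; apply: prodr_gt0.
have w0 S : S \in powerset D -> 0 < f S * \prod_(g in S) x g.
  by move=> SD; rewrite mulr_gt0 ?f0 ?px.
have := log_sum b0 w0; rewrite b1 ltr01 mul1r div1r => /(_ isT).
rewrite lnV; last first.
  by rewrite posrE; apply: maff_gt0 => // S SD; apply: f0; rewrite powersetE.
rewrite -/(maff f D x).
suff -> : \sum_(S in powerset D) b S * ln (b S / (f S * \prod_(g in S) x g)) =
    \sum_(S in powerset D) b S * ln (b S / f S) - \sum_(g in D) mu g * ln (x g).
  lra.
have -> : \sum_(g in D) mu g * ln (x g) =
    \sum_(S in powerset D) \sum_(g in S) b S * ln (x g).
  rewrite sum_powerset_exchange; apply: eq_bigr => g gD.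
  by rewrite -mulr_suml bmu.
rewrite -sumrB; apply: eq_bigr => S SD.
have := b0 S SD; rewrite le_eqVlt => /predU1P[<-|bS].
  by rewrite !mul0r big1 ?subr0 // => g _; rewrite mul0r.
rewrite -mulr_sumr -mulrBr -ln_prod_gt0; last exact: xS.
by rewrite -ln_div ?posrE ?divr_gt0 ?f0 ?px // invfM mulrA.
Qed.

(** For the Gibbs distribution, [ln (b S / f S)] is exactly the logarithm of the monomial minus that
    of the normalization. *)
Lemma gibbs_eq D f mu x :
  (forall S, S \in powerset D -> 0 < f S) ->
  {in D, forall g, 0 < x g} ->
  let b S := f S * (\prod_(g in S) x g) / maff f D x in
  {in D, forall g, \sum_(S in powerset D | g \in S) b S = mu g} ->
  \sum_(S in powerset D) b S * ln (b S / f S) =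
  \sum_(g in D) mu g * ln (x g) - ln (maff f D x).
Proof.
move=> f0 x0 b bmu.
have m0 : 0 < maff f D x.
  by apply: maff_gt0 => // S SD; apply: f0; rewrite powersetE.
have b1 : \sum_(S in powerset D) b S = 1 by rewrite -mulr_suml divff ?gt_eqF.
rewrite -[ln (maff _ _ _)]mul1r -b1 mulr_suml.
have -> : \sum_(g in D) mu g * ln (x g) =
    \sum_(S in powerset D) \sum_(g in S) b S * ln (x g).
  rewrite sum_powerset_exchange; apply: eq_bigr => g gD.
  by rewrite -mulr_suml bmu.
rewrite -sumrB; apply: eq_bigr => S SD; rewrite -mulr_sumr -mulrBr.
have xS : {in S, forall g, 0 < x g}.
  by move: SD; rewrite powersetE => SD g gS; apply/x0/(subsetP SD).
rewrite -ln_prod_gt0 // -ln_div ?posrE ?prodr_gt0 //.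
congr (_ * ln _); rewrite /b; field.
by rewrite !gt_eqF // f0.
Qed.

End Gibbs.

(** * Compactness, minimizers and Gibbs distributions with given marginals *)

Section Extrema.
Import boolp classical_sets topology normedtype derive.
Import numFieldNormedType.Exports.
Local Open Scope classical_set_scope.

Section Continuity.
Variables (R : realType) (Y : topologicalType).

Lemma continuous_sum (I : Type) (r : seq I) (P : pred I) (F : I -> Y -> R) :
  (forall i, P i -> continuous (F i)) ->
  continuous (fun y => \sum_(i <- r | P i) F i y).
Proof.
move=> cF; elim: r => [|i r IH].
  under eq_fun do rewrite big_nil; exact: cst_continuous.
under eq_fun do rewrite big_cons; case Pi: (P i) => // x.
by apply: continuousD; [exact: cF|exact: IH].
Qed.

Lemma continuous_mul (f g : Y -> R) :
  continuous f -> continuous g -> continuous (fun y => f y * g y).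
Proof. by move=> cf cg x; apply: continuousM; [exact: cf|exact: cg]. Qed.

Lemma continuous_add (f g : Y -> R) :
  continuous f -> continuous g -> continuous (fun y => f y + g y).
Proof. by move=> cf cg x; apply: continuousD; [exact: cf|exact: cg]. Qed.

Lemma continuous_sub (f g : Y -> R) :
  continuous f -> continuous g -> continuous (fun y => f y - g y).
Proof. by move=> cf cg x; apply: continuousB; [exact: cf|exact: cg]. Qed.

Lemma continuous_fun_comp (f : Y -> R) (h : R -> R) :
  continuous f -> continuous h -> continuous (fun y => h (f y)).
Proof. by move=> cf ch x; apply: continuous_comp; [exact: cf|exact: ch]. Qed.

End Continuity.

(** The function vanishes for [x <= 0]. At 0 from the right, with [s] the square root of [y], the
    bound [ln s^-1 <= s^-1 - 1] gives [- (y * ln y) <= 2 * s]. *)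
Lemma continuous_xlnx (R : realType) : continuous (fun x : R => x * ln x).
Proof.
move=> x; have [x0|x0|->] := ltgtP x 0.
- apply: (@near_cst_continuous _ _ 0); near=> y.
  rewrite ln0 ?mulr0 // ltW //; near: y; exact: lt_nbhsl.
- by apply: continuousM => //; exact: continuous_ln.
apply/cvgrPdist_lt => e e0; rewrite mul0r.
pose d := Num.min 1 ((e / 2) ^+ 2).
have d0 : 0 < d by rewrite lt_min ltr01 exprn_gt0 ?divr_gt0.
near=> y; have yd : y < d by near: y; exact: lt_nbhsl.
have [y0|y0] := leP y 0; first by rewrite ln0 // mulr0 subrr normr0.
move: yd; rewrite lt_min => /andP[y1 ye].
have s0 : 0 < Num.sqrt y by rewrite sqrtr_gt0.
have ys : y = Num.sqrt y ^+ 2 by rewrite sqr_sqrtr // ltW.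
have se : Num.sqrt y < e / 2.
  by rewrite -(ltr_pXn2r (n := 2)) ?nnegrE ?ltW ?divr_gt0 // -ys.
rewrite sub0r normrN ler0_norm; last by rewrite mulr_ge0_le0 ?ltW // ln_lt0 ?y0.
have lny : ln y = 2 * ln (Num.sqrt y) by rewrite {1}ys lnXn // mulr_natl.
have := ln_le_subr1 (x := (Num.sqrt y)^-1); rewrite invr_gt0 => /(_ s0).
rewrite lnV ?posrE // => H.
have := ler_wpM2l (ltW s0) H; rewrite mulrBr divff ?gt_eqF // mulr1 => H2.
rewrite lny {1}ys.
have -> : - (Num.sqrt y ^+ 2 * (2 * ln (Num.sqrt y))) =
  2 * Num.sqrt y * (Num.sqrt y * - ln (Num.sqrt y)) by ring.
have := ler_wpM2l (ltW s0) H2; nra.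
Unshelve. all: by end_near.
Qed.

(** Tychonoff and the extreme value theorem; it serves both for the gauges and for the beliefs. *)
Lemma exists_min_on_box (R : realType) (T : finType) (lo hi : R)
    (F : (T -> R) -> R) (P : set (T -> R)) :
  continuous (F : prod_topology (fun _ : T => (R : topologicalType)) -> R) ->
  closed (P : set (prod_topology (fun _ : T => (R : topologicalType)))) ->
  (exists2 y, P y & forall i, lo <= y i <= hi) ->
  exists y, [/\ P y, (forall i, lo <= y i <= hi) &
    forall y', P y' -> (forall i, lo <= y' i <= hi) -> F y <= F y'].
Proof.
move=> cF cP [y0 Py0 y0b].
have cB : compact [set y : prod_topology (fun _ : T => (R : topologicalType)) |
    forall i, `[lo, hi]%classic (y i)].
  exact: (@tychonoff T (fun=> (R : topologicalType)) (fun=> `[lo, hi]%classic)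
    (fun=> @segment_compact R lo hi)).
have cBP := compact_closedI cB cP.
have [||y] := @compact_EVT_min
    (prod_topology (fun _ : T => (R : topologicalType))) R F _ _ cBP.
- by exists y0; split => // i; rewrite /= in_itv /=; exact: y0b.
- exact: continuous_subspaceT.
rewrite inE => -[yb Py] ymin; exists y; split => // y' Py' y'b.
by apply: ymin; rewrite inE; split => // i; rewrite /= in_itv /=; exact: y'b.
Qed.

Lemma finite_lower_bound (R : realType) (I : finType) (P : pred I) (f : I -> R) :
  (forall i, P i -> 0 < f i) -> exists2 m, 0 < m & forall i, P i -> m <= f i.
Proof.
move=> f0; have s0 (Q : pred I) : (forall i, Q i -> P i) ->
    0 <= \sum_(i | Q i) (f i)^-1.
  by move=> QP; apply: sumr_ge0 => i Qi; rewrite invr_ge0 ltW ?f0 ?QP.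
have p0 : 0 < 1 + \sum_(i | P i) (f i)^-1 by rewrite ltr_pwDl ?s0.
exists (1 + \sum_(i | P i) (f i)^-1)^-1; first by rewrite invr_gt0.
move=> i Pi; rewrite -[f i]invrK lef_pV2 ?posrE ?invr_gt0 ?f0 //.
rewrite (bigD1 i) //=; have h := s0 (fun j => P j && (j != i)).
suff : 0 <= \sum_(j | P j && (j != i)) (f j)^-1 by lra.
by apply: h => j /andP[].
Qed.

(** The first-order condition at the minimum [t = 0]: the derivative there is
    [k = (1 - m) * b - m * a]. A quadratic upper bound on [expR], tested at [t = - (k * s)] with [s]
    small, excludes [k != 0]. *)
Lemma exp_balance (R : realType) (a b m d : R) : 0 <= a -> 0 <= b ->
  0 < m < 1 -> 0 < d ->
  (forall t, `|t| < d ->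
     a + b <= a * expR (- (m * t)) + b * expR ((1 - m) * t)) ->
  b = m * (a + b).
Proof.
move=> a0 b0 /andP[m0 m1] d0 H.
have expB (y : R) : `|y| <= 1 / 2 -> expR y <= 1 + y + 2 * y ^+ 2.
  rewrite ler_norml => /andP[y1 y2].
  have := expR_ge1Dx (- y); rewrite expRN => h.
  have e0 := expR_gt0 y.
  have h2 : (1 - y) * expR y <= 1.
    by have := ler_wpM2r (ltW e0) h; rewrite mulVf ?gt_eqF.
  have y2' : 0 <= y ^+ 2 := sqr_ge0 y.
  have h3 : 1 <= (1 - y) * (1 + y + 2 * y ^+ 2) by nra.
  have : (1 - y) * expR y <= (1 - y) * (1 + y + 2 * y ^+ 2) by lra.
  by rewrite ler_pM2l //; lra.
pose k := (1 - m) * b - m * a.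
suff : k = 0 by rewrite /k; lra.
apply/eqP; apply: contraT => kn0.
pose d' := Num.min d (1 / 2); have d'0 : 0 < d' by rewrite lt_min d0; lra.
have k0 : 0 < `|k| by rewrite normr_gt0.
(* [N] is large enough for the test point to be admissible and for the quadratic error to stay below
   the linear gain. *)
pose N := 4 * (a + b) + 2 * `|k| + 1; have N0 : 0 < N by rewrite /N; lra.
pose s := d' / N; have s0 : 0 < s by rewrite divr_gt0.
have sN : s * N = d' by rewrite divfK ?gt_eqF.
have tlt : `|- (k * s)| < d'.
  by rewrite normrN normrM (gtr0_norm s0) -sN /N; nra.
have [td th] : `|- (k * s)| < d /\ `|- (k * s)| < 1 / 2.
  by move: tlt; rewrite lt_min => /andP[].
have := H _ td.
have nm : 0 <= `|- (k * s)| := normr_ge0 _.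
have e1 := @expB (- (m * - (k * s))); have e2 := @expB ((1 - m) * - (k * s)).
have {}e1 : expR (- (m * - (k * s))) <=
    1 - m * - (k * s) + 2 * (m * - (k * s)) ^+ 2.
  have := e1; rewrite sqrrN; apply; rewrite normrN normrM (gtr0_norm m0); nra.
have m1' : 0 < 1 - m by lra.
have {}e2 : expR ((1 - m) * - (k * s)) <=
    1 + (1 - m) * - (k * s) + 2 * ((1 - m) * - (k * s)) ^+ 2.
  by apply: e2; rewrite normrM (gtr0_norm m1'); nra.
move=> h.
have f1 := ler_wpM2l a0 e1; have f2 := ler_wpM2l b0 e2.
have ks0 : 0 <= (k * s) ^+ 2 := sqr_ge0 _.
have mm : m ^+ 2 <= 1 by nra.
have mm' : (1 - m) ^+ 2 <= 1 by nra.
have g1 : a * (m ^+ 2 * (k * s) ^+ 2) <= a * (k * s) ^+ 2.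
  by rewrite ler_wpM2l //; nra.
have g2 : b * ((1 - m) ^+ 2 * (k * s) ^+ 2) <= b * (k * s) ^+ 2.
  by rewrite ler_wpM2l //; nra.
have key : 0 <= - (k * (k * s)) + 2 * (a + b) * (k * s) ^+ 2.
  rewrite /k in f1 f2 g1 g2 h *; nra.
have k2 : 0 < k ^+ 2 by rewrite exprn_even_gt0.
have : 0 <= k ^+ 2 * s * (2 * (a + b) * s - 1).
  by apply: le_trans key _; rewrite le_eqVlt; apply/orP; left; apply/eqP; ring.
have ks : 0 < k ^+ 2 * s by rewrite mulr_gt0.
rewrite (pmulr_rge0 _ ks) => h1.
have dh : d' <= 1 / 2 by rewrite ge_min lexx orbT.
have : 4 * (a + b) * s <= d' by rewrite -sN /N; nra.
lra.
Qed.

(* The gauge [x = expR \o theta] minimizes [maff f D x / \prod_g x g ^ mu g],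
   which tends to infinity with [theta] because [0 < mu < 1]. *)
Lemma gibbs_exists (R : realType) (T : finType) (D : {set T})
    (f : {set T} -> R) (mu : T -> R) :
  (forall S, S \in powerset D -> 0 < f S) ->
  {in D, forall g, 0 < mu g < 1} ->
  exists2 x : T -> R, (forall g, 0 < x g) &
    {in D, forall g, \sum_(S in powerset D | g \in S) f S * \prod_(h in S) x h
                     = mu g * maff f D x}.
Proof.
move=> f0 mu01.
have [m m0 mf] := finite_lower_bound f0.
have [k k0 km] : exists2 k : R, 0 < k & forall g, g \in D -> k <= mu g /\ k <= 1 - mu g.
  have [k1 k10 k1m] := @finite_lower_bound R T (mem D) mu
    (fun g gD => proj1 (andP (mu01 g gD))).
  have [k2 k20 k2m] := @finite_lower_bound R T (mem D) (fun g => 1 - mu g)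
    (fun g gD => etrans (subr_gt0 _ _) (proj2 (andP (mu01 g gD)))).
  exists (Num.min k1 k2); first by rewrite lt_min k10.
  by move=> g gD; rewrite !ge_min k1m // k2m // orbT.
(* The logarithm of the monomial [S] divided by [\prod_g x g ^ mu g], so that [Psi] is the function
   to minimize. *)
pose ex (th : T -> R) (S : {set T}) :=
  \sum_(g in S) th g - \sum_(g in D) mu g * th g.
pose Psi (th : T -> R) := \sum_(S in powerset D) f S * expR (ex th S).
pose Z0 := \sum_(S in powerset D) f S.
have Z00 : 0 <= Z0 by apply: sumr_ge0 => S SD; apply/ltW/f0.
pose M := Z0 / (m * k).
have M0 : 0 <= M by apply: divr_ge0 => //; apply: mulr_ge0; exact: ltW.
have cPsi : continuous (Psi : prod_topology (fun _ : T => (R : topologicalType)) -> R).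
  apply: continuous_sum => S _; apply: continuous_mul; first exact: cst_continuous.
  apply: (@continuous_fun_comp _ _ _ expR); last exact: continuous_expR.
  apply: continuous_sub; apply: continuous_sum => g _.
    exact: (@proj_continuous T (fun=> (R : topologicalType)) g).
  apply: continuous_mul; first exact: cst_continuous.
  exact: (@proj_continuous T (fun=> (R : topologicalType)) g).
have [|th [_ thb thmin]] := @exists_min_on_box R T (- M) M Psi setT cPsi closedT.
  by exists (fun=> 0) => // i; rewrite oppr_le0 M0.
have Psi0 : Psi (fun=> 0) = Z0.
  apply: eq_bigr => S _; rewrite /ex big1 // [X in 0 - X]big1 => [|g _].
    by rewrite subrr expR0 mulr1.
  by rewrite mulr0.
have thZ : Psi th <= Z0.
  by rewrite -Psi0; apply: thmin => // i; rewrite oppr_le0 M0.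
(* The minimizer avoids the boundary of the box: with [S] the set of positive coordinates, each [h]
   adds at least [k * |th h|] to the exponent. A coordinate of size [M] would force [Psi th >= m *
   expR (k * M) > m * (k * M) = Z0], the value at 0. *)
have thlt g : g \in D -> `|th g| < M.
  move=> gD; rewrite ltNge; apply/negP => Mth.
  pose S := [set h in D | 0 < th h].
  have SD : S \in powerset D.
    by rewrite powersetE; apply/fintype.subsetP => h; rewrite inE => /andP[].
  have exS : k * `|th g| <= ex th S.
    have -> : ex th S = \sum_(h in D) ((if 0 < th h then th h else 0) - mu h * th h).
      rewrite sumrB; congr (_ - _); rewrite -big_mkcondr; apply: eq_bigl => h.
      by rewrite inE.
    have tm h : h \in D ->
        k * `|th h| <= (if 0 < th h then th h else 0) - mu h * th h.
      move=> hD; have [k1 k2] := km h hD; case: ltP => th0.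
        by rewrite gtr0_norm //; nra.
      by rewrite ler0_norm //; nra.
    rewrite (bigD1 g) //=; apply: le_trans (tm g gD) _; rewrite lerDl.
    apply: sumr_ge0 => h /andP[hD _]; apply: le_trans (tm h hD).
    by rewrite mulr_ge0 // ltW.
  suff : Z0 < Psi th by rewrite ltNge thZ.
  apply: (@lt_le_trans _ _ (m * expR (k * M))).
    have kM : m * (k * M) = Z0 by rewrite /M; field; rewrite !gt_eqF.
    by rewrite -[X in X < _]kM ltr_pM2l // (lt_le_trans _ (expR_ge1Dx _)) // ltrDr.
  rewrite /Psi (bigD1 S) //= -[X in X <= _]addr0 lerD //.
    rewrite ler_pM ?expR_ge0 ?mf ?(ltW m0) // ler_expR.
    by apply: le_trans exS; rewrite ler_pM2l.
  apply: sumr_ge0 => S' /andP[S'D _]; rewrite mulr_ge0 ?expR_ge0 // ltW // f0 //.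
exists (fun g => expR (th g)) => [g|g gD]; first exact: expR_gt0.
pose A := \sum_(S in powerset D | g \notin S) f S * expR (ex th S).
pose B := \sum_(S in powerset D | g \in S) f S * expR (ex th S).
have Fp S : S \in powerset D -> 0 <= f S * expR (ex th S).
  by move=> SD; rewrite mulr_ge0 ?expR_ge0 // ltW // f0.
have A0 : 0 <= A by apply: sumr_ge0 => S /andP[SD _]; exact: Fp.
have B0 : 0 <= B by apply: sumr_ge0 => S /andP[SD _]; exact: Fp.
have AB : Psi th = A + B by rewrite /Psi (bigID (fun S : {set T} => g \in S)) addrC.
have d0 : 0 < M - `|th g| by rewrite subr_gt0 thlt.
have BE : B = mu g * (A + B).
  (* Moving the coordinate [g] alone by [t] rescales the terms without [g] and those with [g] by the
     two exponentials of [exp_balance]. *)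
  apply: exp_balance A0 B0 (mu01 g gD) d0 _ => t td.
  pose th' h := if h == g then th h + t else th h.
  have th'b i : - M <= th' i <= M.
    rewrite /th'; case: eqP => [->|_ //]; rewrite -ler_norml.
    by apply: le_trans (ler_normD _ _) _; lra.
  rewrite -AB; apply: le_trans (thmin th' I th'b) _; rewrite le_eqVlt; apply/orP; left; apply/eqP.
  have muE : \sum_(h in D) mu h * th' h = \sum_(h in D) mu h * th h + mu g * t.
    rewrite (bigD1 g) //= [in RHS](bigD1 g) //= /th' eqxx.
    rewrite (eq_bigr (fun h => mu h * th h)); first ring.
    by move=> h /andP[_ /negbTE ->].
  have ex0 (S : {set T}) : g \notin S -> ex th' S = ex th S - mu g * t.
    move=> gS; rewrite /ex muE (eq_bigr th); first ring.
    by move=> h hS; rewrite /th'; case: eqP hS gS => // -> ->.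
  have ex1 (S : {set T}) : g \in S -> ex th' S = ex th S + (1 - mu g) * t.
    move=> gS; rewrite /ex muE (bigD1 g) //= [in RHS](bigD1 g) //= /th' eqxx.
    rewrite (eq_bigr th); first ring.
    by move=> h /andP[_ /negbTE ->].
  rewrite /Psi (bigID (fun S : {set T} => g \in S)) /= addrC; congr (_ + _).
    rewrite mulr_suml; apply: eq_bigr => S /andP[_ gS].
    by rewrite ex0 // expRD mulrA.
  rewrite mulr_suml; apply: eq_bigr => S /andP[_ gS].
  by rewrite ex1 // expRD mulrA.
pose c := \sum_(g in D) mu g * th g.
have xE S : f S * \prod_(h in S) expR (th h) = f S * expR (ex th S) * expR c.
  by rewrite -expR_sum -mulrA -expRD /ex subrK.
rewrite /maff; under eq_bigr do rewrite xE.
under [in RHS]eq_bigr do rewrite xE.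
by rewrite -!mulr_suml -/(Psi th) AB -/B {1}BE mulrA.
Qed.

End Extrema.

(** * The Bethe free energy *)

Section BetheFreeEnergy.
Variables (R : realType) (V E : finType).
Implicit Types (G : multiGM R V E) (a : V) (al : E) (s S : {set E * bool}).
Implicit Types q : (V -> {set E * bool} -> R) * (E -> R).

(* Continuous in [q] on the whole space, as [x * ln x] is and [ln x = 0] for
   [x <= 0]; the quotient in [bethe_free_energy] is avoided. *)
Definition bethe_xlnx G q : R :=
  \sum_(a in nodes G) \sum_(s in Sigma G a)
      (q.1 a s * ln (q.1 a s) - q.1 a s * ln (factor G a s))
  - \sum_(al in edges G) (q.2 al * ln (q.2 al) + (1 - q.2 al) * ln (1 - q.2 al)).

Lemma bethe_xlnxE G q : soft G -> local_polytope G q ->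
  bethe_free_energy G q = bethe_xlnx G q.
Proof.
move=> sG [b01 _ _ _]; congr (_ - _); apply: eq_bigr => a aG.
apply: eq_bigr => s sa; have /andP[b0 _] := b01 a s aG sa.
have f0 := sG a s aG sa; move: b0; rewrite le_eqVlt => /predU1P[<-|b0].
  by rewrite !mul0r subr0.
by rewrite ln_div ?posrE // mulrBr.
Qed.

Lemma dedges_at_edges G a g : g \in dedges_at G a -> g.1 \in edges G.
Proof. by rewrite !inE => /andP[]. Qed.

Lemma eq_local_polytope G q q' :
  (forall a s, a \in nodes G -> s \in Sigma G a -> q.1 a s = q'.1 a s) ->
  {in edges G, q.2 =1 q'.2} ->
  local_polytope G q -> local_polytope G q'.
Proof.
move=> q1 q2 [H1 H2 H3 H4]; split.
- by move=> a s aG sa; rewrite -q1 ?H1.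
- by move=> e eG; rewrite -q2 ?H2.
- by move=> a aG; rewrite -(H3 a aG); apply: eq_bigr => s sa; rewrite q1.
move=> a g aG ga; rewrite -q2 ?(dedges_at_edges ga) // -(H4 a g aG ga).
by apply: eq_bigr => s /andP[sa _]; rewrite q1.
Qed.

Lemma eq_bethe_free_energy G q q' :
  (forall a s, a \in nodes G -> s \in Sigma G a -> q.1 a s = q'.1 a s) ->
  {in edges G, q.2 =1 q'.2} ->
  bethe_free_energy G q = bethe_free_energy G q'.
Proof.
move=> q1 q2; congr (_ - _); last by apply: eq_bigr => e /q2 ->.
by apply: eq_bigr => a aG; apply: eq_bigr => s sa; rewrite q1.
Qed.

(** * Existence of the Bethe minimum and reduction to interior beliefs *)

Section Topology.
Import boolp classical_sets topology normedtype derive.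
Import numFieldNormedType.Exports.
Local Open Scope classical_set_scope.

Lemma continuous_bethe_xlnx G (Y : topologicalType)
    (q : Y -> (V -> {set E * bool} -> R) * (E -> R)) :
  (forall a s, continuous (fun y => (q y).1 a s)) ->
  (forall e, continuous (fun y => (q y).2 e)) ->
  continuous (fun y => bethe_xlnx G (q y)).
Proof.
move=> cb cbeta; apply: continuous_sub; apply: continuous_sum => a _.
  apply: continuous_sum => s _; apply: continuous_sub.
    exact: continuous_fun_comp (cb a s) (@continuous_xlnx R).
  by apply: continuous_mul; [exact: cb|exact: cst_continuous].
apply: continuous_add; first exact: continuous_fun_comp (@continuous_xlnx R).
apply: (@continuous_fun_comp _ _ (fun y => 1 - (q y).2 a)) (@continuous_xlnx R).
by apply: continuous_sub; [exact: cst_continuous|exact: cbeta].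
Qed.

Lemma min_betheP G : soft G -> (exists q, local_polytope G q) ->
  is_min_bethe G (min_bethe G).
Proof.
move=> sG [q0 q0P]; apply: xgetPex.
pose I := ((V * {set E * bool}) + E)%type.
pose qof (y : I -> R) := ((fun a s => y (inl (a, s))), (fun e : E => y (inr e))).
pose X := prod_topology (fun _ : I => (R : topologicalType)).
have cproj i : continuous (fun y : X => (y i : R)).
  exact: (@proj_continuous I (fun=> (R : topologicalType)) i).
have cF : continuous ((fun y => bethe_xlnx G (qof y)) : X -> R).
  apply: (@continuous_bethe_xlnx G X qof) => [a s|e]; exact: cproj.
pose P1 a := (fun y : X => \sum_(s in Sigma G a) y (inl (a, s))) @^-1` [set x | x = 1].
pose P2 (p : V * (E * bool)) := (fun y : X =>
  \sum_(s in Sigma G p.1 | p.2 \in s) y (inl (p.1, s)) - y (inr p.2.1))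
    @^-1` [set x | x = 0].
pose P : set X := (\bigcap_(a in [set a | a \in nodes G]) P1 a) `&`
  (\bigcap_(p in [set p | p.1 \in nodes G /\ p.2 \in dedges_at G p.1]) P2 p).
have cP : closed P.
  apply: closedI; apply: closed_bigI => i _.
    move: (@closed_eq R 1); apply: (proj1 (continuous_closedP _)).
    by apply: continuous_sum => s _; exact: cproj.
  move: (@closed_eq R 0); apply: (proj1 (continuous_closedP _)).
  apply: continuous_sub; last exact: cproj.
  by apply: continuous_sum => s _; exact: cproj.
have PP (y : X) : P y -> (forall i, 0 <= y i <= 1) -> local_polytope G (qof y).
  move=> [y1 y2] y01; split => [a s _ _|e _|a aG|a g aG ga];
    [exact: y01|exact: y01|exact: y1|].
  by apply/eqP; rewrite -subr_eq0; apply/eqP; exact: (y2 (a, g)).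
(* Irrelevant coordinates are set to 0, which places every point of the polytope in the compact box
   without changing its free energy. *)
pose clip q : I -> R := fun i => match i with
  | inl p => if (p.1 \in nodes G) && (p.2 \in Sigma G p.1) then q.1 p.1 p.2 else 0
  | inr e => if e \in edges G then q.2 e else 0 end.
have clip1 q a s : a \in nodes G -> s \in Sigma G a -> q.1 a s = (qof (clip q)).1 a s.
  by move=> aG sa /=; rewrite aG sa.
have clip2 q : {in edges G, q.2 =1 (qof (clip q)).2} by move=> e /= ->.
have clipP q : local_polytope G q -> P (clip q) /\ forall i, 0 <= clip q i <= 1.
  move=> qP; have [_ _ p3 p4] := eq_local_polytope (clip1 q) (clip2 q) qP.
  case: (qP) => b01 be01 _ _.
  split; last first.
    move=> [[a s]|e] /=; case: ifP => [h|_]; rewrite ?lexx ?ler01 //.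
      by case/andP: h => aG sa; exact: b01.
    exact: be01.
  split => [a /= aG|[a g] /= [aG ga]]; first exact: p3.
  by apply/eqP; rewrite subr_eq0; apply/eqP; exact: (p4 a g aG ga).
have [|y [Py y01 ymin]] := @exists_min_on_box R I 0 1 _ P cF cP.
  by exists (clip q0); have [] := clipP _ q0P.
exists (bethe_free_energy G (qof y)); split; first by exists (qof y) => //; exact: PP.
move=> q qP; have [cq cq01] := clipP _ qP.
have qP' := eq_local_polytope (clip1 q) (clip2 q) qP.
rewrite (eq_bethe_free_energy (clip1 q) (clip2 q)) !bethe_xlnxE //.
  exact: ymin.
exact: PP.
Qed.

Definition interior G q := forall a s, a \in nodes G -> s \in Sigma G a -> 0 < q.1 a s.

(** Moving [q] slightly towards the interior point [u] makes it interior, while by continuity its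
    free energy would stay below [v]. *)
Lemma bethe_ge_of_interior G v u : soft G -> local_polytope G u -> interior G u ->
  (forall q, local_polytope G q -> interior G q -> v <= bethe_free_energy G q) ->
  forall q, local_polytope G q -> v <= bethe_free_energy G q.
Proof.
move=> sG uP ui H q qP; rewrite leNgt; apply/negP => qv.
pose p (t : R) := ((fun a s => (1 - t) * q.1 a s + t * u.1 a s),
  (fun e => (1 - t) * q.2 e + t * u.2 e)).
have cp (c d : R) : continuous (fun t : R => (1 - t) * c + t * d).
  apply: continuous_add; apply: continuous_mul; try exact: cst_continuous.
    by apply: continuous_sub; [exact: cst_continuous|move=> t; exact: cvg_id].
  move=> t; exact: cvg_id.
have cF : continuous (fun t : R => bethe_xlnx G (p t)).
  by apply: continuous_bethe_xlnx => [a s|e]; exact: cp.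
have p0 : bethe_xlnx G (p 0) = bethe_free_energy G q.
  rewrite -(@eq_bethe_free_energy G (p 0) q) ?bethe_xlnxE //=.
  - apply: (@eq_local_polytope G q) => //= [a s _ _|e _]; ring.
  - by move=> a s _ _ /=; ring.
  by move=> e _ /=; ring.
have : bethe_xlnx G (p 0) < v by rewrite p0.
move/(cvgr_lt _ (cF 0)) => /nbhs_ballP[e /= e0 eball].
pose t := Num.min (e / 2) (1 / 2).
have t0 : 0 < t by rewrite lt_min !divr_gt0.
have te : t < e by rewrite gt_min; apply/orP; left; lra.
have t1 : t <= 1 / 2 by rewrite ge_min lexx orbT.
have s0 : 0 < 1 - t by lra.
have lt_v : bethe_xlnx G (p t) < v.
  by apply: eball; rewrite /ball /= sub0r normrN gtr0_norm.
have pP : local_polytope G (p t).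
  case: qP => q1 q2 q3 q4; case: uP => u1 u2 u3 u4; split => /=.
  - move=> a s aG sa; have /andP[? ?] := q1 a s aG sa.
    by have /andP[? ?] := u1 a s aG sa; apply/andP; split; nra.
  - move=> al alG; have /andP[? ?] := q2 al alG.
    by have /andP[? ?] := u2 al alG; apply/andP; split; nra.
  - by move=> a aG; rewrite big_split /= -!mulr_sumr q3 // u3 //; ring.
  by move=> a g aG ga; rewrite big_split /= -!mulr_sumr q4 // u4.
have pI : interior G (p t).
  move=> a s aG sa /=; case: qP => q1 _ _ _; have /andP[? ?] := q1 a s aG sa.
  by have := ui a s aG sa; nra.
by have := H _ pP pI; rewrite bethe_xlnxE // leNgt lt_v.
Qed.

End Topology.

Lemma sum_dedges_at G (F : E * bool -> R) : wf G ->
  \sum_(a in nodes G) \sum_(g in dedges_at G a) F g = \sum_(g in dedges G) F g.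
Proof.
move=> wfG; rewrite [RHS](partition_big (attach G) (mem (nodes G))) //=.
by apply: eq_bigr => a aG; apply: eq_bigl => g; rewrite !inE.
Qed.

Lemma maff_node_gt0 G a (x : E * bool -> R) : soft G -> a \in nodes G ->
  (forall g, 0 < x g) -> 0 < maff (factor G a) (dedges_at G a) x.
Proof.
move=> sG aG x0; apply: maff_gt0 => // s sD; apply: sG => //.
by rewrite powersetE.
Qed.

Lemma ln_maff_weight G (x : E * bool -> R) : wf G -> soft G ->
  (forall g, 0 < x g) ->
  ln (maff (weight G) (dedges G) x) =
  \sum_(a in nodes G) ln (maff (factor G a) (dedges_at G a) x).
Proof.
move=> wfG sG x0.
have /= <- := prod_node_maff (idfun : {rmorphism R -> R}) x wfG.
by apply: ln_prod_gt0 => a aG; exact: maff_node_gt0.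
Qed.

(** [gibbs_le] summed over the nodes. The bound involves the node polynomials only through their
    product, whose coefficients are controlled under contraction. *)
Lemma bethe_weak_duality G q (x : E * bool -> R) : wf G -> soft G ->
  local_polytope G q -> (forall g, 0 < x g) ->
  \sum_(g in dedges G) q.2 g.1 * ln (x g) - ln (maff (weight G) (dedges G) x) <=
  \sum_(a in nodes G) \sum_(s in Sigma G a) q.1 a s * ln (q.1 a s / factor G a s).
Proof.
move=> wfG sG [b01 _ b1 bm] x0; rewrite ln_maff_weight // -sum_dedges_at // -sumrB.
apply: ler_sum => a aG; apply: (gibbs_le (mu := fun g => q.2 g.1)).
- by move=> s sa; have /andP[] := b01 a s aG sa.
- exact: b1.
- by move=> g ga; exact: bm.
- by move=> s sa; exact: sG.
by move=> g _; exact: x0.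
Qed.

(** Strong duality for prescribed interior marginals: Gibbs distributions are chosen node by
    node. *)
Lemma gibbs_beliefs G (beta : E -> R) : wf G -> soft G ->
  {in edges G, forall e, 0 < beta e < 1} ->
  exists (b : V -> {set E * bool} -> R) (x : E * bool -> R),
  [/\ (forall g, 0 < x g), local_polytope G (b, beta), interior G (b, beta) &
    \sum_(a in nodes G) \sum_(s in Sigma G a) b a s * ln (b a s / factor G a s) =
    \sum_(g in dedges G) beta g.1 * ln (x g) - ln (maff (weight G) (dedges G) x)].
Proof.
move=> wfG sG beta01.
have ex_a a : exists xa : E * bool -> R, a \in nodes G -> (forall g, 0 < xa g) /\
    {in dedges_at G a, forall g,
      \sum_(S in powerset (dedges_at G a) | g \in S)
        factor G a S * \prod_(h in S) xa h =
      beta g.1 * maff (factor G a) (dedges_at G a) xa}.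
  case: (boolP (a \in nodes G)) => aG; last by exists (fun=> 1).
  have fa S : S \in powerset (dedges_at G a) -> 0 < factor G a S by exact: sG.
  have [|xa xa0 xam] := gibbs_exists (mu := fun g => beta g.1) fa.
    by move=> g /dedges_at_edges; exact: beta01.
  by exists xa.
have [xs xsP] := boolp.choice ex_a.
(* Each directed edge is attached to a single node, so the gauges of the nodes glue without
   conflict. *)
pose x g := if attach G g \in nodes G then xs (attach G g) g else 1.
have x0 g : 0 < x g.
  by rewrite /x; case: ifP => // aG; exact: (xsP _ aG).1.
have xE a : a \in nodes G -> {in dedges_at G a, xs a =1 x}.
  by move=> aG g; rewrite /x !inE => /andP[_ /eqP ->]; rewrite aG.
have mE a : a \in nodes G -> maff (factor G a) (dedges_at G a) (xs a) =
    maff (factor G a) (dedges_at G a) x.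
  by move=> aG; apply: eq_maff => //; exact: xE.
pose h a := maff (factor G a) (dedges_at G a) x.
have h0 a : a \in nodes G -> 0 < h a by move=> aG; exact: maff_node_gt0.
pose b a s := factor G a s * (\prod_(g in s) x g) / h a.
have bm a g : a \in nodes G -> g \in dedges_at G a ->
    \sum_(s in Sigma G a | g \in s) b a s = beta g.1.
  move=> aG ga; rewrite -mulr_suml.
  rewrite (eq_bigr (fun s => factor G a s * \prod_(h in s) xs a h)).
    by rewrite (xsP a aG).2 // mE // mulfK // gt_eqF // h0.
  move=> s /andP[]; rewrite powersetE => sD _; congr (_ * _).
  by apply: eq_bigr => g' g's; rewrite (xE a aG) // (subsetP sD).
have b0 a s : a \in nodes G -> s \in Sigma G a -> 0 < b a s.
  by move=> aG sa; rewrite divr_gt0 ?h0 // mulr_gt0 ?sG // prodr_gt0.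
have b1 a : a \in nodes G -> \sum_(s in Sigma G a) b a s = 1.
  by move=> aG; rewrite -mulr_suml -/(maff _ _ x) -/(h a) divff // gt_eqF // h0.
exists b, x; split => //.
  split => //= [a s aG sa|e /beta01/andP[? ?]].
    rewrite ltW ?b0 //= -(b1 a aG) (bigD1 s) //= lerDl sumr_ge0 // => s' /andP[s'a _].
    by rewrite ltW // b0.
  by rewrite !ltW.
rewrite ln_maff_weight // -sum_dedges_at // -sumrB; apply: eq_bigr => a aG.
rewrite -(gibbs_eq (mu := fun g => beta g.1) (f := factor G a)) //.
  by move=> s; exact: sG.
by move=> g ga; exact: bm.
Qed.

Lemma interior_polytope G : wf G -> soft G ->
  exists2 q, local_polytope G q & interior G q.
Proof.
move=> wfG sG; have [|b [x [_ bP bi _]]] := @gibbs_beliefs G (fun=> 1 / 2) wfG sG.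
  by move=> e _; apply/andP; split; lra.
by exists (b, fun=> 1 / 2).
Qed.

(** The belief in the configuration [[set g]] keeps the marginal above 0, and the belief in [set0]
    keeps it below 1. *)
Lemma interior_marginals G q : wf G -> local_polytope G q -> interior G q ->
  {in edges G, forall e, 0 < q.2 e < 1}.
Proof.
move=> wfG [_ _ b1 bm] qi e eG.
pose g := primary e; pose a := attach G g.
have gG : g \in dedges G by rewrite inE.
have aG : a \in nodes G by exact: wfG.
have ga : g \in dedges_at G a by rewrite inE gG eqxx.
have gS : [set g] \in Sigma G a by rewrite powersetE sub1set.
have S0 : set0 \in Sigma G a by rewrite powersetE sub0set.
have := bm a g aG ga; rewrite /= => bg; have := b1 a aG.
rewrite (bigID (fun s : {set E * bool} => g \in s)) /= bg.
rewrite (bigD1 set0) ?S0 ?inE //=.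
have : 0 < q.2 e.
  rewrite -bg (bigD1 [set g]) ?gS ?set11 //=.
  apply: ltr_pwDl; first exact: qi.
  by apply: sumr_ge0 => s /andP[/andP[sa _] _]; rewrite ltW // qi.
have : 0 <= \sum_(i | (i \in Sigma G a) && (g \notin i) && (i != set0)) q.1 a i.
  by apply: sumr_ge0 => s /andP[/andP[sa _] _]; rewrite ltW // qi.
by have := qi a set0 aG S0; lra.
Qed.

Lemma maff_weight_contract G al (x : E * bool -> R) : wf G -> al \in edges G ->
  maff (weight (contract G al)) (dedges (contract G al)) x =
  maff (weight G) (dedges (contract G al)) x +
  maff (fun S => weight G (primary al |: (reverse al |: S)))
    (dedges (contract G al)) x.
Proof.
by move=> wfG alG; rewrite -maffD; apply: eq_maff => // S; exact: weight_contract.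
Qed.

(* The Gibbs beliefs [b'] of the contracted model with marginals [q.2] attain
   the dual value at a gauge [x]; weak duality for [q] is applied to the gauge
   that extends [x] to the two directed versions of [al] by [bivariate_bound]. *)
Lemma bethe_contract G al q : wf G -> soft G -> al \in edges G ->
  mastable (signed (@esign R E) (weight G)) (dedges G) ->
  local_polytope G q -> interior G q ->
  exists2 q', local_polytope (contract G al) q' &
    bethe_free_energy (contract G al) q' <= bethe_free_energy G q.
Proof.
move=> wfG sG alG st qP qi.
have q01 := interior_marginals wfG qP qi.
set G' := contract G al; have wfG' : wf G' by exact: wf_contract.
have sG' : soft G' by exact: soft_contract.
have [|b' [x [x0 b'P _ b'E]]] := @gibbs_beliefs G' q.2 wfG' sG'.
  by move=> e; rewrite inE => /andP[_]; exact: q01.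
exists (b', q.2) => //; rewrite /bethe_free_energy [X in X - _ <= _]b'E.
rewrite edges_contract [X in _ <= _ - X](bigD1 al) //=.
under [X in _ - X <= _]eq_bigl do rewrite !inE andbC.
set D := dedges G'; set p := primary al; set r := reverse al.
have pD : p \notin D by exact: primary_contract.
have rD : r \notin D by exact: reverse_contract.
have pr : p != r by rewrite /p /r /primary /reverse xpair_eqE andbF.
have prD : p \notin r |: D by rewrite in_setU1 negb_or pr.
have DE : dedges G = p |: (r |: D) by exact: dedges_contract.
have w0 S : 0 < weight G S by exact: soft_weight_gt0.
(* The four instances of [m] are the coefficients [p_ij] in the two variables of [al], the others
   being fixed at the gauge [x]. *)
pose m (F : {set E * bool} -> {set E * bool}) := maff (fun S => weight G (F S)) D x.
have m0 F : 0 < m F by apply: maff_gt0.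
have ray : m (fun S => p |: S) * m (fun S => r |: S) <=
    m id * m (fun S => p |: (r |: S)).
  apply: (@rayleigh _ _ p r D (@esign R E)) => //; first exact: esign_sqr.
  by rewrite -DE.
have [[x1 x2] /= [x10 x20 bb]] := bivariate_bound (m0 id)
  (m0 (fun S => p |: (r |: S))) (m0 _) (m0 _) ray (q01 al alG).
pose X g := if g == p then x1 else if g == r then x2 else x g.
have X0 g : 0 < X g by rewrite /X; do 2?case: ifP => // _.
have XD : {in D, X =1 x}.
  by move=> g gD; rewrite /X; case: eqP gD pD => [-> ->|_] //;
    case: eqP rD => [-> /negbTE ->|].
have := bethe_weak_duality wfG sG qP X0.
have mX (F : {set E * bool} -> {set E * bool}) :
    maff (fun S => weight G (F S)) D X = m F by exact: eq_maff.
have -> : maff (weight G) (dedges G) X = m id + x1 * m (fun S => p |: S) +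
    x2 * m (fun S => r |: S) + x1 * x2 * m (fun S => p |: (r |: S)).
  rewrite DE !maff_setU1 //.
  rewrite (mX id) (mX (fun S => r |: S)) (mX (fun S => p |: S)).
  rewrite (mX (fun S => p |: (r |: S))) /X eqxx eq_sym (negbTE pr) eqxx; ring.
rewrite DE !big_setU1 //=.
rewrite (eq_bigr (fun g => q.2 g.1 * ln (x g))) => [|g gD]; last by rewrite XD.
rewrite {1 2}/X eqxx eq_sym (negbTE pr) eqxx.
rewrite maff_weight_contract // -/(m id) -/(m (fun S => p |: (r |: S))).
rewrite mulrDr in bb; lra.
Qed.

(** A minimizer of the original model may lie on the boundary, where marginals can be 0 or 1; the
    comparison is therefore made at interior points and extended. *)
Lemma min_bethe_contract G al : wf G -> soft G -> al \in edges G ->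
  mastable (signed (@esign R E) (weight G)) (dedges G) ->
  min_bethe (contract G al) <= min_bethe G.
Proof.
move=> wfG sG alG st.
have wfG' := wf_contract wfG alG; have sG' := soft_contract wfG alG sG.
have [u uP ui] := interior_polytope wfG sG.
have [u' uP' _] := interior_polytope wfG' sG'.
have [[q qP qE] _] := min_betheP sG (ex_intro _ u uP).
have [_ min'] := min_betheP sG' (ex_intro _ u' uP').
rewrite -qE; apply: (bethe_ge_of_interior sG uP ui) qP => q' qP' qi'.
have [q'' qP'' le] := bethe_contract wfG sG alG st qP' qi'.
exact: le_trans (min' _ qP'') le.
Qed.

Lemma Zvbp_contract G al : wf G -> soft G -> al \in edges G ->
  mastable (signed (@esign R E) (weight G)) (dedges G) ->
  Zvbp G <= Zvbp (contract G al).
Proof.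
by move=> wfG sG alG st; rewrite ler_expR lerN2; exact: min_bethe_contract.
Qed.

(** Normalization forces belief 1 in the empty configuration at every node, so the free energy is
    minus the sum of the logarithms of the remaining factors. *)
Lemma Zvbp_no_edge G : wf G -> soft G -> edges G = set0 ->
  Zvbp G = partition_function G.
Proof.
move=> wfG sG eG0.
have Sig a : Sigma G a = [set set0].
  rewrite /Sigma -powerset0; congr powerset; apply/setP => g.
  by rewrite !inE eG0 inE.
have f0 a : a \in nodes G -> 0 < factor G a set0.
  by move=> aG; apply: sG => //; rewrite Sig set11.
have [u uP _] := interior_polytope wfG sG.
have [[q [_ _ q1 _] qE] _] := min_betheP sG (ex_intro _ u uP).
rewrite partition_functionE eG0 powerset0 big_set1 /weight.
have -> : [set g : E * bool | g.1 \in set0] = set0 by apply/setP => g; rewrite !inE.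
under eq_bigr do rewrite set0I.
rewrite /Zvbp -qE /bethe_free_energy eG0 big_set0 subr0 -sumrN expR_sum.
apply: eq_bigr => a aG; have := q1 a aG; rewrite Sig !big_set1 => ->.
by rewrite mul1r div1r lnV ?posrE ?f0 // opprK lnK ?posrE ?f0.
Qed.

End BetheFreeEnergy.

(** * The elimination sequence *)

Section Elimination.
Variables (R : realType) (V E : finType).
Implicit Types (G : multiGM R V E) (al : seq E).

Lemma eliminateS G al m e0 : (m < size al)%N ->
  eliminate G al m.+1 = contract (eliminate G al m) (nth e0 al m).
Proof. by move=> mal; rewrite /eliminate (take_nth e0) // foldl_rcons. Qed.

Lemma edges_eliminate G al m : (m <= size al)%N ->
  edges (eliminate G al m) = edges G :\: [set e in take m al].
Proof.
elim: m => [_|m IH mal].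
  by rewrite /eliminate take0 /=; apply/setP => e; rewrite !inE.
case: al mal IH => // e0 al mal IH.
rewrite (eliminateS _ e0) // edges_contract IH ?(ltnW mal) // (take_nth e0) //.
by apply/setP => e; rewrite !inE mem_rcons inE negb_or andbA.
Qed.

Lemma nth_edges_eliminate G al m e0 : edges G = [set: E] -> uniq al ->
  (m < size al)%N -> nth e0 al m \in edges (eliminate G al m).
Proof.
move=> eG ual mal; rewrite edges_eliminate ?(ltnW mal) // eG !inE andbT.
move: ual; rewrite -(cat_take_drop m al) (drop_nth e0) // cat_uniq.
case/and3P => _ /hasPn/(_ (nth e0 al m)); rewrite inE eqxx => /(_ isT) /= nin _.
rewrite nth_cat size_take mal ltnn subnn /=.
by rewrite take_size_cat // size_take mal.
Qed.

(** The first three properties are what a contraction step both uses and preserves; the last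
    identifies the final estimate with the original partition function. *)
Lemma eliminate_invariant G al m : edges G = [set: E] -> uniq al ->
  wf G -> soft G -> mastable (signed (@esign R E) (weight G)) (dedges G) ->
  (m <= size al)%N ->
  let H := eliminate G al m in
  [/\ wf H, soft H, mastable (signed (@esign R E) (weight H)) (dedges H) &
      partition_function H = partition_function G].
Proof.
move=> eG ual wfG sG st /=; elim: m => [_|m IH mal].
  by rewrite /eliminate take0.
(* A default element for [nth], which exists because the list of edges is nonempty here. *)
have e0 : E by case: al mal {ual IH} => [|e0 _ _]; [rewrite ltn0|exact: e0].
have [wfH sH stH pH] := IH (ltnW mal).
have e_in := nth_edges_eliminate e0 eG ual mal.
rewrite (eliminateS _ e0 mal); split.
- exact: wf_contract.
- exact: soft_contract.
- exact: bi_stable_contract.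
by rewrite partition_function_contract.
Qed.

End Elimination.

Theorem mainTheorem1 (R : realType) (V E : finType) (attach : E * bool -> V)
    (f : V -> {set E * bool} -> R) (al : seq E) :
  let G := fullGM attach f in
  soft G ->
  bi_stable (gm_poly G) ->
  perm_eq al (enum E) ->
  (forall m : nat, (m <= #|E|)%N -> bi_stable (gm_poly (eliminate G al m))) /\
  [/\ Zvbp G = Zvbp (eliminate G al 0),
      forall m : nat, (m < #|E|)%N ->
        Zvbp (eliminate G al m) <= Zvbp (eliminate G al m.+1)
    & Zvbp (eliminate G al #|E|) = partition_function G].
Proof.
move=> G sG stG alE.
have ual : uniq al by rewrite (perm_uniq alE) enum_uniq.
have sal : size al = #|E| by rewrite (perm_size alE) -cardE.
have eG : edges G = [set: E] by [].
have wfG : wf G by move=> g _; rewrite inE.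
have st := proj1 (bi_stableE wfG) stG.
have inv m := @eliminate_invariant R V E G al m eG ual wfG sG st.
rewrite sal in inv; split; last split.
- by move=> m /inv[wfH _ stH _]; apply/bi_stableE.
- by rewrite /eliminate take0.
- move=> m mE; have [wfH sH stH _] := inv m (ltnW mE).
  case: al sal mE ual {alE inv} wfH sH stH => [<- //|e0 al] sal mE ual wfH sH stH.
  rewrite (eliminateS _ e0) ?sal //; apply: Zvbp_contract => //.
  by apply: nth_edges_eliminate; rewrite ?sal.
have [wfH sH _ <-] := inv #|E| (leqnn _).
(* The ordering lists every edge, so none is left after the last step. *)
apply: Zvbp_no_edge => //; rewrite edges_eliminate ?sal // -sal take_size.
by apply/setP => e; rewrite !inE (perm_mem alE) mem_enum.
Qed.
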